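(* Let $ABCD$ be a generic quadrilateral in $\mathbb{R}^2$ whose diagonal vectors $\overrightarrow{AC}$ and $\overrightarrow{BD}$ are linearly independent, let $\mathcal{F}$ be the periodic framework associated to $ABCD$, and choose a vertex of $\mathcal{F}$. Then $\mathcal{F}$ has a local auxetic deformation if and only if the conic passing through the chosen vertex and the endpoints of the four bars emanating from it is an ellipse.
   Context: **Quadrilaterals.** A quadrilateral $ABCD$ is a closed planar four-bar linkage with vertices $A,B,C,D\in\mathbb{R}^2$ and bars (edges) $AB, BC, CD, DA$ of positive length; it may be convex, non-convex or self-intersecting. It is called generic when the sum of its longest and shortest edge lengths is different from the sum of the other two edge lengths. **Associated periodic framework.** Let $L$ be the rank two lattice generated by $\overrightarrow{AC}$ and $\overrightarrow{BD}$. The periodic framework $\mathcal{F}$ associated to $ABCD$ is the planar bar-and-joint framework consisting of all translates of the quadrilateral by vectors in $L$, with shared vertices identified as single joints. Its periodicity group is $\Gamma\cong\mathbb{Z}^2$, acting by translations by $L$, with generators $\gamma_1,\gamma_2$ represented by $\overrightarrow{AC},\overrightarrow{BD}$. There are two vertex orbits, $A+L$ (containing $C$) and $B+L$ (containing $D$), and four edge orbits, those of $AB,BC,CD,DA$. Every vertex has exactly four bars emanating from it; for example, the other endpoints of the four bars at $A$ are $B$, $D$, $B-\overrightarrow{AC}$, $D-\overrightarrow{AC}$. An ellipse means a non-degenerate real ellipse (circles included). **Deformations.** Let $V$ be the (infinite) vertex set of the underlying graph. A placement is a pair $(p,\pi)$ where $p:V\to\mathbb{R}^2$ and $\pi$ is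 an injective homomorphism from $\Gamma$ to the group of translations of $\mathbb{R}^2$, whose image is a lattice of rank $2$, with $p(\gamma v)=\pi(\gamma)(p(v))$ for all $v\in V$, $\gamma\in\Gamma$. A one-parameter deformation of $\mathcal{F}$ is a smooth family of placements $(p_\tau,\pi_\tau)$, $\tau\in(-\epsilon,\epsilon)$, of the same periodic graph, equal to the given placement at $\tau=0$, such that all edge lengths are constant in $\tau$; the lattice $\pi_\tau(\Gamma)$ may vary. Let $\Lambda_\tau$ be the $2\times2$ matrix with columns the translation vectors $\pi_\tau(\gamma_1),\pi_\tau(\gamma_2)$, and let $\omega_\tau=\Lambda_\tau^t\Lambda_\tau$ be the Gram matrix of this lattice basis. The deformation is called auxetic when $\frac{d\omega_\tau}{d\tau}$ is positive semidefinite for every $\tau\in(-\epsilon,\epsilon)$. The framework has a local auxetic deformation if, for some $\epsilon>0$, it has an auxetic one-parameter deformation that is non-trivial in the sense that $\frac{d\omega_\tau}{d\tau}\neq0$ at $\tau=0$. *)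

(* Defs.v *)
From mathcomp Require Import all_boot all_order all_algebra.
From mathcomp Require Import all_classical all_reals all_analysis.

Set Implicit Arguments.
Unset Strict Implicit.
Unset Printing Implicit Defensive.

Import Order.TTheory GRing.Theory Num.Theory.
Import numFieldNormedType.Exports.

Local Open Scope classical_set_scope.
Local Open Scope ring_scope.

(* The library's norm on matrices is the sup norm, hence the Euclidean
   structure of the plane 'cV[R]_2 is spelled out here. *)
Definition dotp (R : realType) (u v : 'cV[R]_2) : R := \sum_i u i 0 * v i 0.

Definition eudist (R : realType) (x y : 'cV[R]_2) : R :=
  Num.sqrt (dotp (y - x) (y - x)).

Definition edge_lengths (R : realType) (A B C D : 'cV[R]_2) : seq R :=
  [:: eudist A B; eudist B C; eudist C D; eudist D A].

Definition quadrilateral (R : realType) (A B C D : 'cV[R]_2) : Prop :=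
  forall l, l \in edge_lengths A B C D -> 0 < l.

Definition generic (R : realType) (A B C D : 'cV[R]_2) : Prop :=
  let s := sort <=%R (edge_lengths A B C D) in s`_0 + s`_3 <> s`_1 + s`_2.

(* The periodicity group, in the basis gamma1, gamma2. *)
Notation Gam := (int * int)%type.
Definition gamma1 : Gam := (1, 0).
Definition gamma2 : Gam := (0, 1).

(* VA g and VB g are the translates by g of A and B; thus C = VA gamma1 and
   D = VB gamma2.  The graph is abstract, with two free vertex orbits: joints
   that merely happen to occupy the same position are not identified. *)
Inductive vertex : Type := VA of Gam | VB of Gam.

Definition act (g : Gam) (v : vertex) : vertex :=
  match v with VA h => VA (g + h) | VB h => VB (g + h) end.

Inductive bar : vertex -> vertex -> Prop :=
  | barAB (g : Gam) : bar (VA g) (VB g)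
  | barBC (g : Gam) : bar (VB g) (VA (g + gamma1))
  | barCD (g : Gam) : bar (VA (g + gamma1)) (VB (g + gamma2))
  | barDA (g : Gam) : bar (VB (g + gamma2)) (VA g).

Definition joined (v w : vertex) : Prop := bar v w \/ bar w v.

Definition rank2_lattice (R : realType) (L : set 'cV[R]_2) : Prop :=
  exists u v : 'cV[R]_2, free [:: u; v] /\
    L = [set x | exists m n : int, x = u *~ m + v *~ n].

(* A translation of the plane is represented by its translation vector. *)
Definition placement (R : realType)
    (p : vertex -> 'cV[R]_2) (pi : Gam -> 'cV[R]_2) : Prop :=
  [/\ forall g h, pi (g + h) = pi g + pi h,
      injective pi,
      rank2_lattice (range pi) &
      forall g v, p (act g v) = p v + pi g].

Definition framework_trans (R : realType) (A B C D : 'cV[R]_2) (g : Gam) :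
  'cV[R]_2 := (C - A) *~ g.1 + (D - B) *~ g.2.

Definition framework_pos (R : realType) (A B C D : 'cV[R]_2) (v : vertex) :
  'cV[R]_2 :=
  match v with
  | VA g => A + framework_trans A B C D g
  | VB g => B + framework_trans A B C D g
  end.

Definition smooth_on (R : realType) (e : R) (f : R -> 'cV[R]_2) : Prop :=
  forall (n : nat) (t : R), t \in `]- e, e[ -> derivable (derive1n n f) t 1.

(* Only the values of the families at parameters in ]-e, e[ matter. *)
Definition deformation (R : realType) (A B C D : 'cV[R]_2) (e : R)
    (p : R -> vertex -> 'cV[R]_2) (pi : R -> Gam -> 'cV[R]_2) : Prop :=
  [/\ forall t : R, t \in `]- e, e[ -> placement (p t) (pi t),
      forall v, smooth_on e (fun t => p t v),
      forall g, smooth_on e (fun t => pi t g),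
      p 0 =1 framework_pos A B C D /\ pi 0 =1 framework_trans A B C D &
      forall v w, bar v w -> forall t : R, t \in `]- e, e[ ->
        eudist (p t v) (p t w) = eudist (p 0 v) (p 0 w)].

Definition lattice_basis (R : realType) (pi : Gam -> 'cV[R]_2) : 'M[R]_2 :=
  row_mx (pi gamma1) (pi gamma2).

Definition gram (R : realType) (pi : Gam -> 'cV[R]_2) : 'M[R]_2 :=
  (lattice_basis pi)^T *m lattice_basis pi.

Definition psd (R : realType) (M : 'M[R]_2) : Prop :=
  M^T = M /\ forall x : 'cV[R]_2, 0 <= (x^T *m M *m x) 0 0.

Definition auxetic (R : realType) (e : R) (pi : R -> Gam -> 'cV[R]_2) : Prop :=
  forall t : R, t \in `]- e, e[ -> psd (derive1 (fun s => gram (pi s)) t).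

Definition has_local_auxetic_deformation (R : realType)
    (A B C D : 'cV[R]_2) : Prop :=
  exists (e : R) (p : R -> vertex -> 'cV[R]_2) (pi : R -> Gam -> 'cV[R]_2),
    [/\ 0 < e,
        deformation A B C D e p pi,
        auxetic e pi &
        derive1 (fun s => gram (pi s)) 0 <> 0].

Definition is_conic (R : realType) (K : set 'cV[R]_2) : Prop :=
  exists a b c d e f : R, (a, b, c) <> (0, 0, 0) /\
    K = [set x : 'cV[R]_2 | let X := x 0 0 in let Y := x 1 0 in
      a * X ^+ 2 + b * X * Y + c * Y ^+ 2 + d * X + e * Y + f = 0].

Definition the_conic_through (R : realType) (S K : set 'cV[R]_2) : Prop :=
  [/\ is_conic K, S `<=` K &
      forall K', is_conic K' -> S `<=` K' -> K' = K].

(* Centre o, axes along the orthonormal frame (u, v), semi-axes a and b. *)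
Definition is_ellipse (R : realType) (K : set 'cV[R]_2) : Prop :=
  exists (o u v : 'cV[R]_2) (a b : R),
    [/\ dotp u u = 1, dotp v v = 1, dotp u v = 0, 0 < a /\ 0 < b &
        K = [set x | (dotp (x - o) u / a) ^+ 2
                     + (dotp (x - o) v / b) ^+ 2 = 1]].

Definition star (v : vertex) : set vertex :=
  [set w | w = v \/ joined v w].

(* Main.v *)
(* Write x = AC, y = BD and w = AB = p x + q y.  Expanding the four edge
   equations shows that x.y is constant along any deformation, so the Gram
   matrix varies only through s = |x|^2 and r = |y|^2, and that
     |w - p x - q y|^2 = p (p - 1) (s - s0) + q (q + 1) (r - r0)
   with p, q, s0, r0 taken at the initial placement.  The left-hand side is
   nonnegative and vanishes initially.
   If p (p - 1) q (q + 1) >= 0 and s, r are nondecreasing, then on one side of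
   0 the right-hand side is also nonpositive; this freezes s and r there, and
   the deformation is trivial.  If the product is negative, moving C along AC
   and turning the two rigid triangles ABC and ADC gives a smooth deformation
   with s' > 0, and differentiating the identity at 0 gives r' > 0.
   The four neighbours of the chosen vertex form a parallelogram with sides
   parallel to x and y; in the affine frame where its corners are (+-1, +-1)
   the conics through them are l (a^2 - 1) + m (b^2 - 1) = 0, and the chosen
   vertex is at (1 - 2 p, -1 - 2 q), so the conic is an ellipse exactly when
   p (p - 1) q (q + 1) < 0. *)
Require Import Defs.
From mathcomp Require Import all_boot all_order all_algebra.
From mathcomp Require Import all_classical all_reals all_analysis.
From mathcomp Require Import ring lra.

Import Order.TTheory GRing.Theory Num.Theory.
Import numFieldNormedType.Exports.
Local Open Scope classical_set_scope.
Local Open Scope ring_scope.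

Set Implicit Arguments.
Unset Strict Implicit.

(** * Plane vectors *)

Definition cross (R : realType) (u v : 'cV[R]_2) : R :=
  u 0 0 * v 1 0 - u 1 0 * v 0 0.

Definition vec2 (R : realType) (a b : R) : 'cV[R]_2 :=
  \col_i (if i == 0 then a else b).

Lemma vec2_0 (R : realType) (a b : R) : vec2 a b 0 0 = a.
Proof. by rewrite mxE. Qed.

Lemma vec2_1 (R : realType) (a b : R) : vec2 a b 1 0 = b.
Proof. by rewrite mxE. Qed.

Lemma ord2P (i : 'I_2) : i = 0 \/ i = 1.
Proof.
case: i => [[|[|//]]] i2; [left|right]; exact/val_inj.
Qed.

Lemma vec2P (R : realType) (u v : 'cV[R]_2) :
  u 0 0 = v 0 0 -> u 1 0 = v 1 0 -> u = v.
Proof.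
by move=> h0 h1; apply/colP => i; case: (ord2P i) => ->.
Qed.

Lemma dotpE (R : realType) (u v : 'cV[R]_2) :
  dotp u v = u 0 0 * v 0 0 + u 1 0 * v 1 0.
Proof.
rewrite /dotp !big_ord_recl big_ord0 addr0.
by rewrite (_ : lift ord0 ord0 = 1 :> 'I_2)//; exact/val_inj.
Qed.

Lemma dotpC (R : realType) (u v : 'cV[R]_2) : dotp u v = dotp v u.
Proof. by rewrite !dotpE; ring. Qed.

Lemma dotpDl (R : realType) (u v w : 'cV[R]_2) :
  dotp (u + v) w = dotp u w + dotp v w.
Proof. by rewrite !dotpE !mxE; ring. Qed.

Lemma dotpDr (R : realType) (u v w : 'cV[R]_2) :
  dotp w (u + v) = dotp w u + dotp w v.
Proof. by rewrite !dotpE !mxE; ring. Qed.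

Lemma dotpNl (R : realType) (u v : 'cV[R]_2) : dotp (- u) v = - dotp u v.
Proof. by rewrite !dotpE !mxE; ring. Qed.

Lemma dotpNr (R : realType) (u v : 'cV[R]_2) : dotp u (- v) = - dotp u v.
Proof. by rewrite !dotpE !mxE; ring. Qed.

Lemma dotpZl (R : realType) k (u v : 'cV[R]_2) :
  dotp (k *: u) v = k * dotp u v.
Proof. by rewrite !dotpE !mxE; ring. Qed.

Lemma dotpZr (R : realType) k (u v : 'cV[R]_2) :
  dotp u (k *: v) = k * dotp u v.
Proof. by rewrite !dotpE !mxE; ring. Qed.

Definition dotp_lin := (dotpDl, dotpDr, dotpNl, dotpNr, dotpZl, dotpZr).

Lemma dotp_ge0 (R : realType) (u : 'cV[R]_2) : 0 <= dotp u u.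
Proof. by rewrite dotpE; nra. Qed.

Lemma dotp_eq0 (R : realType) (u : 'cV[R]_2) : dotp u u = 0 -> u = 0.
Proof.
rewrite dotpE => /eqP; rewrite -!expr2 paddr_eq0 ?sqr_ge0// !sqrf_eq0.
by move=> /andP[/eqP u0 /eqP u1]; apply: vec2P; rewrite mxE.
Qed.

Lemma cross_free (R : realType) (u v : 'cV[R]_2) :
  free [:: u; v] <-> cross u v != 0.
Proof.
split=> [fr|c0].
  apply/negP => /eqP c0.
  have rel : forall a b : R, a *: u + b *: v = 0 -> a = 0 /\ b = 0.
    move=> a b h; move/freeP: fr => fr.
    have := fr (fun i => if val i == 0%N then a else b).
    rewrite !big_ord_recl big_ord0 addr0/= => /(_ h) {}fr.
    by split; [have := fr ord0 | have := fr (lift ord0 ord0)].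
  (* The combination [v i 0 *: u - u i 0 *: v] has entries 0 and plus or minus [cross u v], so it is
     a vanishing relation for both values of i. Freeness then makes [u] and [v] zero, which
     contradicts freeness. *)
  have [] := rel (v 0 0) (- u 0 0).
    by move: c0; rewrite /cross => c0; apply: vec2P; rewrite !mxE; lra.
  move=> v0 /eqP; rewrite oppr_eq0 => /eqP u0.
  have [] := rel (v 1 0) (- u 1 0).
    by move: c0; rewrite /cross => c0; apply: vec2P; rewrite !mxE; lra.
  move=> v1 /eqP; rewrite oppr_eq0 => /eqP u1.
  have [] := rel 1 0 => [|/eqP].
    by apply: vec2P; rewrite !mxE ?u0 ?u1; ring.
  by rewrite oner_eq0.
apply/freeP => k.
rewrite !big_ord_recl big_ord0 addr0/= => h.
have h0 := congr1 (fun M : 'cV[R]_2 => M 0 0) h.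
have h1 := congr1 (fun M : 'cV[R]_2 => M 1 0) h.
move: h0 h1; rewrite !mxE/= => h0 h1.
have k0 : k ord0 * cross u v = 0.
  transitivity (v 1 0 * 0 - v 0 0 * 0 : R); last by ring.
  by rewrite -{1}h0 -h1 /cross; ring.
have k1 : k (lift ord0 ord0) * cross u v = 0.
  transitivity (u 0 0 * 0 - u 1 0 * 0 : R); last by ring.
  by rewrite -{1}h1 -h0 /cross; ring.
move/eqP: k0; rewrite mulf_eq0 (negbTE c0) orbF => /eqP k0.
move/eqP: k1; rewrite mulf_eq0 (negbTE c0) orbF => /eqP k1.
case=> [[|[|//]]] i2.
  by rewrite -[RHS]k0; congr k; exact/val_inj.
by rewrite -[RHS]k1; congr k; exact/val_inj.
Qed.

(** Cramer's rule. *)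
Lemma cross_decomp (R : realType) (u v z : 'cV[R]_2) : cross u v != 0 ->
  z = (cross z v / cross u v) *: u + (cross u z / cross u v) *: v.
Proof.
by rewrite /cross => c0; apply: vec2P; rewrite !mxE; field.
Qed.

(** In the plane [v] is plus or minus the quarter turn of [u]: the sign is D = [cross u v], and D
    squared is 1 by Lagrange's identity. What remains is Lagrange's identity for [z] and [u]. *)
Lemma orthonormal_decomp (R : realType) (u v z : 'cV[R]_2) :
  dotp u u = 1 -> dotp v v = 1 -> dotp u v = 0 ->
  dotp z z = dotp z u ^+ 2 + dotp z v ^+ 2.
Proof.
rewrite !dotpE => uu vv uv.
set a := u 0 0 in uu uv *; set b := u 1 0 in uu uv *.
set c := v 0 0 in uv vv *; set d := v 1 0 in uv vv *.
set x := z 0 0; set y := z 1 0.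
have cE : c = - (a * d - b * c) * b.
  transitivity (c * (a * a + b * b) - a * (a * c + b * d)); last by ring.
  by rewrite uu uv; ring.
have dE : d = (a * d - b * c) * a.
  transitivity (d * (a * a + b * b) - b * (a * c + b * d)); last by ring.
  by rewrite uu uv; ring.
have D1 : (a * d - b * c) ^+ 2 = 1.
  transitivity ((a * a + b * b) * (c * c + d * d) - (a * c + b * d) ^+ 2).
    by ring.
  by rewrite uu uv vv; ring.
set D := a * d - b * c in cE dE D1.
have -> : (x * c + y * d) ^+ 2 = (D ^+ 2) * (y * a - x * b) ^+ 2.
  by rewrite [in LHS]cE [in LHS]dE; ring.
rewrite D1 mul1r.
have -> : (x * a + y * b) ^+ 2 + (y * a - x * b) ^+ 2 =
  (x * x + y * y) * (a * a + b * b) by ring.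
by rewrite uu mulr1.
Qed.

(** The second equation says that the symmetric matrix with rows (a, b) and (b, c) has zero
    off-diagonal entry in the rotated frame (k, s), (-s, k). *)
Lemma rotation_diagonalizes (R : realType) (a b c : R) :
  exists k s : R, k ^+ 2 + s ^+ 2 = 1 /\
    (c - a) * k * s + b * (k ^+ 2 - s ^+ 2) = 0.
Proof.
have [->|b0] := eqVneq b 0; first by exists 1, 0; split; ring.
set D := Num.sqrt ((a - c) ^+ 2 + 4 * b ^+ 2).
have D2 : D ^+ 2 = (a - c) ^+ 2 + 4 * b ^+ 2.
  by rewrite sqr_sqrtr// addr_ge0 ?sqr_ge0// mulr_ge0 ?sqr_ge0.
(* (X, Y) is an eigenvector for the larger eigenvalue (a + c + D) / 2; it is nonzero because b
   is. *)
set X := 2 * b; set Y := c - a + D.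
have XY : 0 < X ^+ 2 + Y ^+ 2.
  by rewrite ltr_pwDl ?sqr_ge0// exprn_even_gt0//= mulf_neq0.
set n := Num.sqrt (X ^+ 2 + Y ^+ 2).
have n2 : n ^+ 2 = X ^+ 2 + Y ^+ 2 by rewrite sqr_sqrtr// ltW.
have n0 : n != 0 by rewrite gt_eqF// sqrtr_gt0.
exists (X / n), (Y / n); split.
  have -> : (X / n) ^+ 2 + (Y / n) ^+ 2 = (X ^+ 2 + Y ^+ 2) / n ^+ 2 by field.
  by rewrite -n2 divff// expf_neq0.
have -> : (c - a) * (X / n) * (Y / n) + b * ((X / n) ^+ 2 - (Y / n) ^+ 2) =
  ((c - a) * X * Y + b * (X ^+ 2 - Y ^+ 2)) / n ^+ 2 by field.
have -> : (c - a) * X * Y + b * (X ^+ 2 - Y ^+ 2) =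
  b * ((a - c) ^+ 2 + 4 * b ^+ 2 - D ^+ 2) by rewrite /X /Y; ring.
by rewrite D2 subrr mulr0 mul0r.
Qed.

(** * Conics through the corners of a parallelogram *)

Definition affc (R : realType) (c u v : 'cV[R]_2) (a b : R) : 'cV[R]_2 :=
  c + a *: u + b *: v.

(** The corners are indexed by pairs of booleans, [true] giving the sign -1, so as to match the
    indexing of the neighbours of a vertex. *)
Definition corners_and_point (R : realType) (c u v : 'cV[R]_2) (al be : R) :
  set 'cV[R]_2 :=
  [set x | (exists ab : bool * bool,
              x = affc c u v ((-1) ^+ ab.1) ((-1) ^+ ab.2))
           \/ x = affc c u v al be].

Lemma corners_sub (R : realType) (c u v : 'cV[R]_2) (al be : R)
    (K : set 'cV[R]_2) :
  corners_and_point c u v al be `<=` K <->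
  [/\ K (affc c u v 1 1), K (affc c u v 1 (-1)), K (affc c u v (-1) 1),
      K (affc c u v (-1) (-1)) & K (affc c u v al be)].
Proof.
split=> [sub|[h1 h2 h3 h4 h5] x].
  split; apply: sub; last by right.
  - by left; exists (false, false).
  - by left; exists (false, true).
  - by left; exists (true, false).
  - by left; exists (true, true).
by case=> [[[[] []] ->]|->].
Qed.

(** Measured along the axes in units of the semi-axes, the ellipse becomes the unit circle, and a
    parallelogram inscribed in a circle is a rectangle with the same centre. With A and C the
    squared half-sides, comparing a corner with the fifth point gives (al^2 - 1) A + (be^2 - 1) C =
    0 with A, C > 0. *)
Lemma ellipse_corners (R : realType) (c u v : 'cV[R]_2) (al be : R)
    (K : set 'cV[R]_2) : cross u v != 0 ->
  ~ (al ^+ 2 = 1 /\ be ^+ 2 = 1) -> is_ellipse K ->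
  corners_and_point c u v al be `<=` K ->
  (al ^+ 2 - 1) * (be ^+ 2 - 1) < 0.
Proof.
move=> uv0 nc [w [e [f [a [b [ee ff ef [a0 b0] ->]]]]]].
move=> /corners_sub; rewrite /affc /=.
have dE (p q : R) (z : 'cV[R]_2) : dotp (c + p *: u + q *: v - w) z =
    dotp (c - w) z + p * dotp u z + q * dotp v z.
  by rewrite !dotp_lin; ring.
have nz (z : 'cV[R]_2) :
    z <> 0 -> 0 < (dotp z e / a) ^+ 2 + (dotp z f / b) ^+ 2.
  move=> z0; rewrite lt_neqAle addr_ge0 ?sqr_ge0// andbT eq_sym.
  rewrite paddr_eq0 ?sqr_ge0// !sqrf_eq0 !mulf_eq0 !invr_eq0.
  rewrite (gt_eqF a0) (gt_eqF b0) !orbF; apply/negP => /andP[/eqP h1 /eqP h2].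
  by apply: z0; apply: dotp_eq0; rewrite (orthonormal_decomp z ee ff ef) h1 h2; ring.
have := nz u; have := nz v; clear nz.
rewrite !dE; set goal := (_ < 0); rewrite !mulrDl.
have H (z : 'cV[R]_2) (p : R) : p * dotp z e / a = p * (dotp z e / a) by ring.
have H' (z : 'cV[R]_2) (p : R) : p * dotp z f / b = p * (dotp z f / b) by ring.
rewrite !H !H' {H H'}.
set d1 := dotp (c - w) e / a; set d2 := dotp (c - w) f / b.
set u1 := dotp u e / a; set u2 := dotp u f / b.
set v1 := dotp v e / a; set v2 := dotp v f / b.
rewrite {}/goal => vpos upos [h1 h2 h3 h4 h5].
have {}vpos : 0 < v1 ^+ 2 + v2 ^+ 2.
  by apply: vpos => v0; move: uv0; rewrite /cross v0 !mxE !mulr0 subr0 eqxx.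
have {}upos : 0 < u1 ^+ 2 + u2 ^+ 2.
  by apply: upos => u0; move: uv0; rewrite /cross u0 !mxE !mul0r subr0 eqxx.
set A := u1 ^+ 2 + u2 ^+ 2 in upos; set C := v1 ^+ 2 + v2 ^+ 2 in vpos.
(* Signed sums of the four circle equations isolate each of the three mixed products; their plain
   sum gives [e4]. *)
have e1 : u1 * v1 + u2 * v2 = 0 by nra.
have e2 : d1 * u1 + d2 * u2 = 0 by nra.
have e3 : d1 * v1 + d2 * v2 = 0 by nra.
have e4 : d1 ^+ 2 + d2 ^+ 2 + A + C = 1 by rewrite /A /C; nra.
have e5 : d1 ^+ 2 + d2 ^+ 2 + al ^+ 2 * A + be ^+ 2 * C = 1.
  transitivity ((d1 + al * u1 + be * v1) ^+ 2 + (d2 + al * u2 + be * v2) ^+ 2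
    - 2 * al * be * (u1 * v1 + u2 * v2) - 2 * al * (d1 * u1 + d2 * u2)
    - 2 * be * (d1 * v1 + d2 * v2)); first by rewrite /A /C; ring.
  by rewrite e1 e2 e3 h5; ring.
have e6 : (al ^+ 2 - 1) * A + (be ^+ 2 - 1) * C = 0 by lra.
have [al1|al1] := eqVneq (al ^+ 2) 1.
  case: nc; split=> //; move/eqP: e6.
  by rewrite al1 subrr mul0r add0r mulf_eq0 (gt_eqF vpos) orbF subr_eq0 => /eqP.
have e7 : be ^+ 2 - 1 = - (al ^+ 2 - 1) * A / C.
  apply: (mulIf (lt0r_neq0 vpos)); rewrite divfK ?gt_eqF//; lra.
have -> : (al ^+ 2 - 1) * (be ^+ 2 - 1) = - ((al ^+ 2 - 1) ^+ 2 * (A / C)).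
  by rewrite e7; ring.
rewrite oppr_lt0 mulr_gt0 ?divr_gt0// exprn_even_gt0//=.
by rewrite subr_eq0.
Qed.

Lemma axial_form_expand (R : realType) (l m D z0 z1 u0 u1 v0 v1 : R) :
  l * ((z0 * v1 - z1 * v0) / D) ^+ 2 + m * ((u0 * z1 - u1 * z0) / D) ^+ 2 =
  (l * v1 ^+ 2 + m * u1 ^+ 2) / D ^+ 2 * z0 ^+ 2
  + 2 * (- (l * v0 * v1 + m * u0 * u1) / D ^+ 2) * z0 * z1
  + (l * v0 ^+ 2 + m * u0 ^+ 2) / D ^+ 2 * z1 ^+ 2.
Proof. by rewrite -!exprVn; move: D^-1 => d; ring. Qed.

Section Conic.
Variables (R : realType) (c u v : 'cV[R]_2) (l m : R).
Hypotheses (uv0 : cross u v != 0) (l0 : 0 < l) (m0 : 0 < m).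

(** By [cross_decomp] the two quotients are the coordinates (a, b) of [x] in the affine frame (c; u,
    v): this is the curve l a^2 + m b^2 = 1. *)
Definition axial_ellipse : set 'cV[R]_2 :=
  [set x | l * (cross (x - c) v / cross u v) ^+ 2
         + m * (cross u (x - c) / cross u v) ^+ 2 = 1].

Lemma axial_affc (a b : R) :
  axial_ellipse (affc c u v a b) <-> l * a ^+ 2 + m * b ^+ 2 = 1.
Proof.
rewrite /axial_ellipse/=.
have -> : cross (affc c u v a b - c) v / cross u v = a.
  by move: uv0; rewrite /affc /cross !mxE => ?; field.
have -> : cross u (affc c u v a b - c) / cross u v = b.
  by move: uv0; rewrite /affc /cross !mxE => ?; field.
by [].
Qed.

(** The form [q] is positive definite, and a rotation diagonalizes it. The axes are the unit
    eigenvectors [e], [f], and each semi-axis is the inverse square root of the value of [q]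
    there. *)
Lemma axial_is_ellipse : is_ellipse axial_ellipse.
Proof.
pose q (z : 'cV[R]_2) := l * (cross z v / cross u v) ^+ 2
                       + m * (cross u z / cross u v) ^+ 2.
have q_gt0 z : z <> 0 -> 0 < q z.
  move=> z0; rewrite lt_neqAle eq_sym; apply/andP; split; last first.
    by rewrite addr_ge0// mulr_ge0 ?sqr_ge0// ltW.
  apply/negP; rewrite paddr_eq0; last 2 first.
  - by rewrite mulr_ge0 ?sqr_ge0// ltW.
  - by rewrite mulr_ge0 ?sqr_ge0// ltW.
  rewrite !mulf_eq0 (gt_eqF l0) (gt_eqF m0)/= !orbb invr_eq0 (negbTE uv0) !orbF.
  move=> /andP[/eqP h1 /eqP h2]; apply: z0.
  by rewrite (cross_decomp z uv0) h1 h2 !mul0r !scale0r addr0.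
set D := cross u v in q q_gt0.
pose a := (l * v 1 0 ^+ 2 + m * u 1 0 ^+ 2) / D ^+ 2.
pose b := - (l * v 0 0 * v 1 0 + m * u 0 0 * u 1 0) / D ^+ 2.
pose g := (l * v 0 0 ^+ 2 + m * u 0 0 ^+ 2) / D ^+ 2.
have qE z : q z = a * z 0 0 ^+ 2 + 2 * b * z 0 0 * z 1 0 + g * z 1 0 ^+ 2.
  exact: axial_form_expand.
have [k [s [ks dg]]] := rotation_diagonalizes a b g.
pose e := vec2 k s; pose f := vec2 (- s) k.
have e0 : e <> 0.
  move=> /(congr1 (fun z : 'cV[R]_2 => dotp z z)).
  rewrite !dotpE /e !vec2_0 !vec2_1 !mxE -!expr2 ks expr0n addr0 => /eqP.
  by rewrite oner_eq0.
have f0 : f <> 0.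
  move=> /(congr1 (fun z : 'cV[R]_2 => dotp z z)).
  rewrite !dotpE /f !vec2_0 !vec2_1 !mxE -!expr2 sqrrN addrC ks expr0n addr0.
  by move/eqP; rewrite oner_eq0.
exists c, e, f, (Num.sqrt (q e))^-1, (Num.sqrt (q f))^-1; split.
- by rewrite dotpE !vec2_0 !vec2_1 -ks; ring.
- by rewrite dotpE !vec2_0 !vec2_1 -ks; ring.
- by rewrite dotpE !vec2_0 !vec2_1; ring.
- by rewrite !invr_gt0 !sqrtr_gt0; split; exact: q_gt0.
apply/seteqP; rewrite -/D.
suff H x : l * (cross (x - c) v / D) ^+ 2 + m * (cross u (x - c) / D) ^+ 2 =
    (dotp (x - c) e / (Num.sqrt (q e))^-1) ^+ 2 +
    (dotp (x - c) f / (Num.sqrt (q f))^-1) ^+ 2.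
  by split=> x; rewrite /axial_ellipse/= H.
rewrite -/(q (x - c)) !invrK !exprMn !sqr_sqrtr ?ltW ?q_gt0//.
set z := x - c; rewrite !qE !dotpE !vec2_0 !vec2_1.
set z0 := z 0 0; set z1 := z 1 0.
(* The inserted factor is 1 and the inserted summand is 0. They make the claim a polynomial
   identity, the summand cancelling the mixed term of [q] in the frame (e, f). *)
transitivity ((a * z0 ^+ 2 + 2 * b * z0 * z1 + g * z1 ^+ 2) * (k ^+ 2 + s ^+ 2) ^+ 2
  + 2 * ((g - a) * k * s + b * (k ^+ 2 - s ^+ 2)) *
    ((z0 * k + z1 * s) * (z0 * s - z1 * k))).
  by rewrite ks dg; ring.
ring.
Qed.

Lemma axial_is_conic : is_conic axial_ellipse.
Proof.
set D := cross u v.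
pose a := (l * v 1 0 ^+ 2 + m * u 1 0 ^+ 2) / D ^+ 2.
pose b := - (l * v 0 0 * v 1 0 + m * u 0 0 * u 1 0) / D ^+ 2.
pose g := (l * v 0 0 ^+ 2 + m * u 0 0 ^+ 2) / D ^+ 2.
exists a, (2 * b), g, (- 2 * (a * c 0 0 + b * c 1 0)),
  (- 2 * (b * c 0 0 + g * c 1 0)),
  (a * c 0 0 ^+ 2 + 2 * b * c 0 0 * c 1 0 + g * c 1 0 ^+ 2 - 1).
have D0 : 0 < D ^+ 2 by rewrite exprn_even_gt0.
split.
  (* The coefficient of X^2 alone cannot vanish: it is a positive combination of the squares of
     [v 1 0] and [u 1 0], which are not both zero. *)
  case=> /eqP; rewrite mulf_eq0 invr_eq0 (gt_eqF D0) orbF.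
  rewrite paddr_eq0; last 2 first.
  - by rewrite mulr_ge0 ?sqr_ge0// ltW.
  - by rewrite mulr_ge0 ?sqr_ge0// ltW.
  rewrite !mulf_eq0 (gt_eqF l0) (gt_eqF m0)/=.
  rewrite !orbb => /andP[/eqP v1 /eqP u1] _ _.
  by move: uv0; rewrite /cross u1 v1 mulr0 mul0r subr0 eqxx.
apply/seteqP.
suff H x : l * (cross (x - c) v / D) ^+ 2 + m * (cross u (x - c) / D) ^+ 2 =
   1 + (a * x 0 0 ^+ 2 + 2 * b * x 0 0 * x 1 0 + g * x 1 0 ^+ 2
   - 2 * (a * c 0 0 + b * c 1 0) * x 0 0 + - 2 * (b * c 0 0 + g * c 1 0) * x 1 0
   + (a * c 0 0 ^+ 2 + 2 * b * c 0 0 * c 1 0 + g * c 1 0 ^+ 2 - 1)).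
  by split=> x; rewrite /axial_ellipse/= -/D H => h; lra.
rewrite axial_form_expand -/a -/b -/g.
have -> : (x - c) 0 0 = x 0 0 - c 0 0 by rewrite !mxE.
have -> : (x - c) 1 0 = x 1 0 - c 1 0 by rewrite !mxE.
ring.
Qed.

(** In frame coordinates the four corners kill the mixed and linear terms and force F = -(A + C).
    The fifth point then fixes the ratio of A to C, so the equation is a multiple of l p^2 + m q^2 =
    1. *)
Lemma conic_corners_unique (al be : R) (K : set 'cV[R]_2) :
  ~ (al ^+ 2 = 1 /\ be ^+ 2 = 1) -> l + m = 1 ->
  l * al ^+ 2 + m * be ^+ 2 = 1 ->
  is_conic K -> corners_and_point c u v al be `<=` K -> K = axial_ellipse.
Proof.
move=> nc lm onE [a [b [g [d [e [f [abg0 ->]]]]]]] /corners_sub.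
set D := cross u v.
pose A := a * u 0 0 ^+ 2 + b * u 0 0 * u 1 0 + g * u 1 0 ^+ 2.
pose B := 2 * a * u 0 0 * v 0 0 + b * (u 0 0 * v 1 0 + u 1 0 * v 0 0)
  + 2 * g * u 1 0 * v 1 0.
pose C := a * v 0 0 ^+ 2 + b * v 0 0 * v 1 0 + g * v 1 0 ^+ 2.
pose E (z : 'cV[R]_2) := 2 * a * c 0 0 * z 0 0 + b * (c 0 0 * z 1 0 + c 1 0 * z 0 0)
  + 2 * g * c 1 0 * z 1 0 + d * z 0 0 + e * z 1 0.
pose F := a * c 0 0 ^+ 2 + b * c 0 0 * c 1 0 + g * c 1 0 ^+ 2 + d * c 0 0
  + e * c 1 0 + f.
have QE p q : let x := affc c u v p q in
    a * x 0 0 ^+ 2 + b * x 0 0 * x 1 0 + g * x 1 0 ^+ 2 + d * x 0 0 + e * x 1 0 + f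
    = A * p ^+ 2 + B * p * q + C * q ^+ 2 + E u * p + E v * q + F.
  by rewrite /affc/= !mxE /A /B /C /E /F; ring.
rewrite /= !QE => -[h1 h2 h3 h4 h5].
have B0 : B = 0 by lra.
have Eu0 : E u = 0 by lra.
have Ev0 : E v = 0 by lra.
have FE : F = - (A + C) by lra.
have h6 : A * (al ^+ 2 - 1) + C * (be ^+ 2 - 1) = 0.
  by move: h5; rewrite B0 Eu0 Ev0 FE => h5; lra.
pose k := A + C.
have h7 : l * (al ^+ 2 - 1) + m * (be ^+ 2 - 1) = 0 by lra.
have [Ak Ck] : A = k * l /\ C = k * m.
  have : (A - k * l) * (al ^+ 2 - 1) + (C - k * m) * (be ^+ 2 - 1) = 0.
    transitivity (A * (al ^+ 2 - 1) + C * (be ^+ 2 - 1)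
      - k * (l * (al ^+ 2 - 1) + m * (be ^+ 2 - 1))); first by ring.
    by rewrite h6 h7; ring.
  (* As l + m = 1, the two defects are opposite, which leaves (A - k l)(al^2 - be^2) = 0. Equal
     squares would both be 1 by [onE], which is excluded. *)
  have CA : C - k * m = - (A - k * l).
    have -> : m = 1 - l by lra.
    by rewrite /k; ring.
  have Cm : C = k * m - (A - k * l) by lra.
  rewrite CA => h8.
  have /eqP : (A - k * l) * (al ^+ 2 - be ^+ 2) = 0 by lra.
  rewrite mulf_eq0 !subr_eq0 => /orP[/eqP Akl|/eqP albe].
    by split=> //; lra.
  exfalso; apply: nc; suff a1 : al ^+ 2 = 1 by rewrite -albe.
  move: onE; rewrite albe -mulrDl lm mul1r => ?; lra.
(* If k = 0, the quadratic part vanishes in frame coordinates; inverting the change of frame, up to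
   the factor [D ^+ 2], makes a, b and g vanish too. *)
have k0 : k != 0.
  apply/negP => /eqP k0; apply: abg0.
  have D20 : D ^+ 2 != 0 by rewrite expf_neq0.
  have A0 : A = 0 by rewrite Ak k0 mul0r.
  have C0 : C = 0 by rewrite Ck k0 mul0r.
  have aE : a * D ^+ 2 = A * v 1 0 ^+ 2 - B * u 1 0 * v 1 0 + C * u 1 0 ^+ 2.
    by rewrite /A /B /C /D /cross; ring.
  have gE : g * D ^+ 2 = A * v 0 0 ^+ 2 - B * u 0 0 * v 0 0 + C * u 0 0 ^+ 2.
    by rewrite /A /B /C /D /cross; ring.
  have bE : b * D ^+ 2 = - 2 * A * v 0 0 * v 1 0
     + B * (u 0 0 * v 1 0 + u 1 0 * v 0 0) - 2 * C * u 0 0 * u 1 0.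
    by rewrite /A /B /C /D /cross; ring.
  have z0 x : x * D ^+ 2 = 0 -> x = 0.
    by move=> /eqP; rewrite mulf_eq0 (negbTE D20) orbF => /eqP.
  have -> : a = 0 by apply: z0; rewrite aE A0 B0 C0; ring.
  have -> : b = 0 by apply: z0; rewrite bE A0 B0 C0; ring.
  by have -> : g = 0 by apply: z0; rewrite gE A0 B0 C0; ring.
apply/seteqP; split=> x /=.
- pose p := cross (x - c) v / D; pose q := cross u (x - c) / D.
  have xE : x = affc c u v p q.
    by rewrite /affc -addrA -(cross_decomp _ uv0) addrC subrK.
  rewrite xE QE axial_affc B0 Eu0 Ev0 FE Ak Ck => h.
  apply: (mulfI k0).
  have : k * (l + m) = k by rewrite lm mulr1.
  by move=> ?; lra.
- pose p := cross (x - c) v / D; pose q := cross u (x - c) / D.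
  have xE : x = affc c u v p q.
    by rewrite /affc -addrA -(cross_decomp _ uv0) addrC subrK.
  rewrite xE axial_affc QE B0 Eu0 Ev0 FE Ak Ck => h.
  transitivity (k * (l * p ^+ 2 + m * q ^+ 2 - (l + m))); first by ring.
  by rewrite h lm subrr mulr0.
Qed.

End Conic.

Lemma conic_corners_ellipse (R : realType) (c u v : 'cV[R]_2) (al be : R) :
  cross u v != 0 -> ~ (al ^+ 2 = 1 /\ be ^+ 2 = 1) ->
  (exists2 K, the_conic_through (corners_and_point c u v al be) K & is_ellipse K)
  <-> (al ^+ 2 - 1) * (be ^+ 2 - 1) < 0.
Proof.
move=> uv0 nc; split=> [[K [_ SK _] eK]|neg].
  exact: (ellipse_corners uv0 nc eK SK).
pose s := be ^+ 2 - al ^+ 2.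
have s0 : s != 0.
  apply/negP => /eqP; rewrite /s => s0.
  have e : be ^+ 2 = al ^+ 2 by lra.
  by move: neg; rewrite e -expr2 ltNge sqr_ge0.
(* The solution of the linear system expressing passage through the corners (l + m = 1) and through
   the fifth point. The denominator is the sum of the two numerators, which have the same sign by
   [neg]; hence both weights are positive. *)
pose l := (be ^+ 2 - 1) / s; pose m := (1 - al ^+ 2) / s.
have lm : l + m = 1 by rewrite /l /m /s; field.
have on : l * al ^+ 2 + m * be ^+ 2 = 1 by rewrite /l /m /s; field.
have [l0 m0] : 0 < l /\ 0 < m.
  have [sp|sn] : 0 < s \/ s < 0 by move: s0; case: (ltgtP s 0) => // ? _; [right|left].
    by split; rewrite divr_gt0//; move: sp neg; rewrite /s; nra.
  by split; rewrite ltr_ndivlMr// mul0r; move: sn neg;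
    rewrite /s; nra.
exists (axial_ellipse c u v l m); last exact: axial_is_ellipse.
split; first exact: axial_is_conic.
- by apply/corners_sub; split; apply/axial_affc; rewrite ?sqrrN ?expr1n ?mulr1.
- by move=> K' cK' SK'; apply: (conic_corners_unique uv0 nc lm on cK' SK').
Qed.

(** * The star of a vertex *)

Lemma framework_transD (R : realType) (A B C D : 'cV[R]_2) (g h : Gam) :
  framework_trans A B C D (g + h) =
  framework_trans A B C D g + framework_trans A B C D h.
Proof. by rewrite /framework_trans !mulrzDr addrACA. Qed.

Lemma framework_transN (R : realType) (A B C D : 'cV[R]_2) (g : Gam) :
  framework_trans A B C D (- g) = - framework_trans A B C D g.
Proof. by rewrite /framework_trans !mulrNz opprD. Qed.

Lemma framework_trans1 (R : realType) (A B C D : 'cV[R]_2) :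
  framework_trans A B C D gamma1 = C - A.
Proof. by rewrite /framework_trans/= mulr0z addr0. Qed.

Lemma framework_trans2 (R : realType) (A B C D : 'cV[R]_2) :
  framework_trans A B C D gamma2 = D - B.
Proof. by rewrite /framework_trans/= mulr0z add0r. Qed.

Lemma framework_trans0 (R : realType) (A B C D : 'cV[R]_2) :
  framework_trans A B C D 0 = 0.
Proof. by rewrite /framework_trans/= !mulr0z addr0. Qed.

(** The second boolean is negated so that each pair of booleans matches the signs of the corner
    occupied by that neighbour. *)
Lemma joined_VA (g : Gam) (z : vertex) : joined (VA g) z <->
  exists ab : bool * bool, z = VB (g - gamma1 *+ ab.1 + gamma2 *+ ~~ ab.2).
Proof.
split=> [[]|[[[] []] /= ->]].
- move E : (VA g) => v b; case: b E => // h [->].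
    by exists (false, true); rewrite /= !mulr0n subr0 addr0.
  by exists (true, false); rewrite /= !mulr1n addrK.
- move E : (VA g) => v b; case: b E => // h [->].
    by exists (true, true); rewrite /= mulr1n mulr0n addrK addr0.
  by exists (false, false); rewrite /= mulr1n mulr0n subr0.
- rewrite mulr0n addr0 mulr1n; right.
  by have := barBC (g - gamma1); rewrite subrK.
- rewrite !mulr1n; left.
  by have := barCD (g - gamma1); rewrite subrK.
- rewrite !mulr0n subr0 addr0; left; exact: barAB.
- rewrite mulr1n mulr0n subr0; right; exact: barDA.
Qed.

Lemma joined_VB (g : Gam) (z : vertex) : joined (VB g) z <->
  exists ab : bool * bool, z = VA (g + gamma1 *+ ab.1 - gamma2 *+ ~~ ab.2).
Proof.
have sym v w : joined v w <-> joined w v by split=> -[]; [right|left|right|left].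
split=> [|[ab ->]]; last first.
  by apply/sym/joined_VA; exists ab; congr VB; rewrite [in RHS]addrAC subrK addrK.
case: z => h /sym; last by case=> b; inversion b.
move=> /joined_VA[ab [->]]; exists ab; congr VA.
by rewrite [RHS]addrAC addrK subrK.
Qed.

Lemma star_corners (R : realType) (A B C D : 'cV[R]_2) (p q : R) (v : vertex) :
  cross (C - A) (D - B) != 0 -> B - A = p *: (C - A) + q *: (D - B) ->
  exists c u w : 'cV[R]_2, cross u w != 0 /\
    framework_pos A B C D @` star v =
    corners_and_point c u w (1 - 2 * p) (- 1 - 2 * q).
Proof.
move=> xy wE; set x := C - A in xy wE; set y := D - B in xy wE.
(* Up to translation, the stars in the two vertex orbits are point reflections of each other; this
   sign treats both at once. *)
pose eps : R := if v is VA _ then 1 else - 1.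
have eps2 : eps * eps = 1 by rewrite /eps; case: (v) => _; ring.
pose P := framework_pos A B C D v.
(* The centre of the parallelogram of neighbours, whose half-sides are x / 2 and y / 2 up to
   [eps]. *)
pose c := P + eps *: (p *: x + q *: y + 2^-1 *: (y - x)).
exists c, ((eps / 2) *: x), ((eps / 2) *: y); split.
  have -> : cross ((eps / 2) *: x) ((eps / 2) *: y) = eps * eps * (cross x y) / 4.
    by rewrite /cross !mxE; field.
  by rewrite eps2 mul1r mulf_neq0// invr_neq0.
have posE : P = affc c ((eps / 2) *: x) ((eps / 2) *: y) (1 - 2 * p) (- 1 - 2 * q).
  by rewrite /affc /c; apply: vec2P; rewrite !mxE; field.
have nbrE (ab : bool * bool) : P + eps *: (B - A - x *+ ab.1 + y *+ ~~ ab.2) =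
    affc c ((eps / 2) *: x) ((eps / 2) *: y) ((-1) ^+ ab.1) ((-1) ^+ ab.2).
  rewrite wE /affc /c; case: ab => [[] []] /=; rewrite ?mulr1n ?mulr0n;
    by apply: vec2P; rewrite !mxE; field.
have nbr z : joined v z <-> exists ab : bool * bool,
    z = (match v with
         | VA g => VB (g - gamma1 *+ ab.1 + gamma2 *+ ~~ ab.2)
         | VB g => VA (g + gamma1 *+ ab.1 - gamma2 *+ ~~ ab.2) end).
  by case: (v) => g; [exact: joined_VA|exact: joined_VB].
have trE (b : bool) (g : Gam) : framework_trans A B C D (g *+ b) =
    framework_trans A B C D g *+ b.
  by case: b; rewrite ?mulr1n// !mulr0n framework_trans0.
have nposE (ab : bool * bool) : framework_pos A B C D (match v with
         | VA g => VB (g - gamma1 *+ ab.1 + gamma2 *+ ~~ ab.2)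
         | VB g => VA (g + gamma1 *+ ab.1 - gamma2 *+ ~~ ab.2) end) =
    P + eps *: (B - A - x *+ ab.1 + y *+ ~~ ab.2).
  rewrite /P /eps; case: (v) => g /=;
  rewrite !framework_transD framework_transN !trE framework_trans1;
  rewrite framework_trans2 -/x -/y; set t := framework_trans A B C D g;
  by apply: vec2P; rewrite !mxE; ring.
apply/seteqP; split=> [_ [z [->|/nbr[ab ->]] <-]|_ [[ab ->]|->]].
- by right; exact: posE.
- by left; exists ab; rewrite nposE nbrE.
- by rewrite -nbrE -nposE; eexists; [right; apply/nbr; exists ab|].
- by rewrite -posE; exists v => //; left.
Qed.

Lemma eudist_gt0 (R : realType) (X Y : 'cV[R]_2) : 0 < eudist X Y -> Y - X <> 0.
Proof.
move=> h e; move: h; rewrite /eudist e (_ : dotp 0 0 = 0) ?sqrtr0 ?ltxx//.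
by rewrite dotpE !mxE; ring.
Qed.

Lemma star_conic_ellipse (R : realType) (A B C D : 'cV[R]_2) (p q : R)
    (v : vertex) : quadrilateral A B C D ->
  cross (C - A) (D - B) != 0 -> B - A = p *: (C - A) + q *: (D - B) ->
  (exists2 K : set 'cV[R]_2,
     the_conic_through (framework_pos A B C D @` star v) K & is_ellipse K)
  <-> (p * (p - 1)) * (q * (q + 1)) < 0.
Proof.
move=> quad xy wE; have [c [u [w [uw ->]]]] := star_corners v xy wE.
rewrite conic_corners_ellipse//; last first.
  (* A vertex at a corner would mean p = 0 or 1 and q = 0 or -1; each of the four combinations
     collapses one edge to length zero. *)
  case=> h1 h2.
  have {h1} /eqP : p * (p - 1) = 0 by lra.
  have {h2} /eqP : q * (q + 1) = 0 by lra.
  have nAB : B - A <> 0 by apply: eudist_gt0; apply: quad; rewrite !inE eqxx.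
  have nBC : C - B <> 0 by apply: eudist_gt0; apply: quad; rewrite !inE eqxx orbT.
  have nCD : D - C <> 0 by apply: eudist_gt0; apply: quad; rewrite !inE eqxx !orbT.
  have nDA : A - D <> 0 by apply: eudist_gt0; apply: quad; rewrite !inE eqxx !orbT.
  rewrite !mulf_eq0 subr_eq0 addr_eq0 => /orP[]/eqP qE /orP[]/eqP pE.
  - by apply: nAB; rewrite wE pE qE !scale0r addr0.
  - apply: nBC; have -> : C - B = (C - A) - (B - A) by apply: vec2P; rewrite !mxE; ring.
    by rewrite wE pE qE scale1r scale0r addr0 subrr.
  - apply: nDA; have -> : A - D = - ((B - A) + (D - B)).
      by apply: vec2P; rewrite !mxE; ring.
    by rewrite wE pE qE scale0r add0r scaleN1r addNr oppr0.
  - apply: nCD; have -> : D - C = (B - A) + (D - B) - (C - A).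
      by apply: vec2P; rewrite !mxE; ring.
    by rewrite wE pE qE scale1r scaleN1r subrK subrr.
have -> : ((1 - 2 * p) ^+ 2 - 1) * ((-1 - 2 * q) ^+ 2 - 1) =
  16 * (p * (p - 1) * (q * (q + 1))) by ring.
by rewrite pmulr_rlt0.
Qed.

(** * Deformations and the Gram matrix *)

Definition basis_vector (R : realType) (pi : Gam -> 'cV[R]_2) (i : 'I_2) :
  'cV[R]_2 := if i == 0 then pi gamma1 else pi gamma2.

Lemma lattice_basisE (R : realType) (pi : Gam -> 'cV[R]_2) (i j : 'I_2) :
  lattice_basis pi i j = basis_vector pi j i 0.
Proof.
rewrite /basis_vector /lattice_basis mxE.
by case: splitP => k; rewrite ord1; case: (ord2P j) => ->.
Qed.

Lemma gramE (R : realType) (pi : Gam -> 'cV[R]_2) (i j : 'I_2) :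
  gram pi i j = dotp (basis_vector pi i) (basis_vector pi j).
Proof.
by rewrite mxE; apply: eq_bigr => k _; rewrite [X in X * _]mxE !lattice_basisE.
Qed.

Lemma psdP (R : realType) (M : 'M[R]_2) : psd M <->
  M 0 1 = M 1 0 /\ forall a b : R,
    0 <= M 0 0 * a ^+ 2 + 2 * M 0 1 * a * b + M 1 1 * b ^+ 2.
Proof.
have sumE (F : 'I_2 -> R) : \sum_i F i = F 0 + F 1.
  rewrite !big_ord_recl big_ord0 addr0; congr (_ + F _); exact/val_inj.
have formE (x : 'cV[R]_2) : (x^T *m M *m x) 0 0 = M 0 0 * x 0 0 ^+ 2
    + (M 0 1 + M 1 0) * x 0 0 * x 1 0 + M 1 1 * x 1 0 ^+ 2.
  by rewrite !mxE sumE !mxE !sumE !mxE; ring.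
split=> [[symM posM]|[M01 posM]].
  have M01 : M 0 1 = M 1 0 by rewrite -[in LHS]symM mxE.
  split=> // a b; have := posM (vec2 a b).
  rewrite formE vec2_0 vec2_1 -M01; congr (_ <= _); ring.
split=> [|x]; last first.
  have := posM (x 0 0) (x 1 0); rewrite formE -M01; congr (_ <= _); ring.
apply/matrixP => i j; rewrite mxE.
by case: (ord2P i) => ->; case: (ord2P j) => ->.
Qed.

Lemma psd_diag_ge0 (R : realType) (M : 'M[R]_2) : psd M ->
  0 <= M 0 0 /\ 0 <= M 1 1.
Proof.
move=> /psdP[_ posM]; split.
  by have := posM 1 0; rewrite expr1n expr0n/= !mulr0 !addr0 mulr1.
by have := posM 0 1; rewrite expr1n expr0n/= !mulr0 mul0r !add0r mulr1.
Qed.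

Lemma derivable_dotp (R : realType) (f g : R -> 'cV[R]_2) (t : R) :
  derivable f t 1 -> derivable g t 1 ->
  derivable (fun s => dotp (f s) (g s)) t 1.
Proof.
move=> /derivable_mxP df /derivable_mxP dg.
rewrite (_ : (fun s => _) = (fun s => f s 0 0) * (fun s => g s 0 0)
    + (fun s => f s 1 0) * (fun s => g s 1 0)).
  by apply: derivableD; apply: derivableM.
by apply/funext => s; rewrite dotpE.
Qed.

Section DeriveGram.
Variables (R : realType) (pi : R -> Gam -> 'cV[R]_2) (t : R).
Hypothesis dpi : forall g, derivable (fun s => pi s g) t 1.

Lemma derivable_basis i : derivable (fun s => basis_vector (pi s) i) t 1.
Proof. by rewrite /basis_vector; case: (i == 0). Qed.

Lemma derivable_gram : derivable (fun s => gram (pi s)) t 1.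
Proof.
apply/derivable_mxP => i j.
rewrite (_ : (fun s => _) = (fun s =>
  dotp (basis_vector (pi s) i) (basis_vector (pi s) j))).
  by apply: derivable_dotp; exact: derivable_basis.
by apply/funext => s; rewrite gramE.
Qed.

Lemma derive_gram i j : derive1 (fun s => gram (pi s)) t i j =
  derive1 (fun s => dotp (basis_vector (pi s) i) (basis_vector (pi s) j)) t.
Proof.
rewrite derive1E (derive_mx derivable_gram) mxE derive1E.
by congr ('D_1 _ t); apply/funext => s; rewrite gramE.
Qed.

End DeriveGram.

(** An existing derivative equals each of its one-sided limits, and on one side the difference
    quotient is zero. Freezing on one side of 0 is all that the sign argument yields. *)
Lemma derive1_const_half (R : realType) (f : R -> R) (e : R) : 0 < e ->
  derivable f 0 1 ->
  (forall h, 0 <= h < e -> f h = f 0) \/ (forall h, - e < h <= 0 -> f h = f 0) ->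
  derive1 f 0 = 0.
Proof.
move=> e0 df fc; rewrite derive1E /derive; case: fc => fc.
- rewrite cvg_at_rightE//; apply: cvg_lim => //; apply: cvg_near_cst.
  near=> h; rewrite /= [_%:A]mulr1 addr0 fc ?subrr ?scaler0//.
  by apply/andP; split; near: h; [exact: nbhs_right_ge|exact: nbhs_right_lt].
- rewrite cvg_at_leftE//; apply: cvg_lim => //; apply: cvg_near_cst.
  near=> h; rewrite /= [_%:A]mulr1 addr0 fc ?subrr ?scaler0//.
  apply/andP; split; near: h; last exact: nbhs_left_le.
  by apply: nbhs_left_gt; rewrite oppr_lt0.
Unshelve. all: by end_near. Qed.

Lemma derive1_ge0_ndecr_oo (R : realType) (f : R -> R) (e : R) :
  (forall t, t \in `]- e, e[ -> derivable f t 1) ->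
  (forall t, t \in `]- e, e[ -> 0 <= derive1 f t) ->
  {in `]- e, e[ &, {homo f : s t / s <= t}}.
Proof.
move=> df f0; apply: (ger0_derive1_le_oo df f0) => t; rewrite inE => tI.
have dft := df t tI.
by apply: differentiable_continuous; apply/derivable1_diffP.
Qed.

(** * Constant edge lengths and their consequences for the diagonals *)

Lemma eudist_dotp (R : realType) (a b c d : 'cV[R]_2) :
  eudist a b = eudist c d <-> dotp (b - a) (b - a) = dotp (d - c) (d - c).
Proof.
rewrite /eudist; split=> [/eqP|->//].
by rewrite eqr_sqrt ?dotp_ge0// => /eqP.
Qed.

(* [w], [x], [y] stand for the vectors AB, AC, BD at some parameter and [w0],
   [x0], [y0] for their initial values. *)
Section EdgeEquations.
Variables (R : realType) (w x y w0 x0 y0 : 'cV[R]_2) (p q : R).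
Hypotheses (w0E : w0 = p *: x0 + q *: y0)
  (AB : dotp w w = dotp w0 w0)
  (BC : dotp (x - w) (x - w) = dotp (x0 - w0) (x0 - w0))
  (CD : dotp (w + y - x) (w + y - x) = dotp (w0 + y0 - x0) (w0 + y0 - x0))
  (DA : dotp (w + y) (w + y) = dotp (w0 + y0) (w0 + y0)).

Let ds := dotp x x - dotp x0 x0.
Let dt := dotp y y - dotp y0 y0.

(** The alternating sum AB^2 - BC^2 + CD^2 - DA^2 of squared lengths equals -2 x.y. *)
Lemma diagonal_dotp_const : dotp x y = dotp x0 y0.
Proof.
move: AB BC CD DA; rewrite !dotp_lin.
rewrite (dotpC x w) (dotpC y w) (dotpC y x) (dotpC x0 w0) (dotpC y0 w0).
by rewrite (dotpC y0 x0) => h1 h2 h3 h4; lra.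
Qed.

(** Law of cosines in the triangle ABC; [wy] is the same in ABD. *)
Let wx : 2 * (dotp w x - dotp w0 x0) = ds.
Proof.
move: AB BC; rewrite !dotp_lin (dotpC x w) (dotpC x0 w0) /ds => h1 h2; lra.
Qed.

Let wy : 2 * (dotp w y - dotp w0 y0) = - dt.
Proof.
move: AB DA; rewrite !dotp_lin (dotpC y w) (dotpC y0 w0) /dt => h1 h2; lra.
Qed.

(** Each scalar product in the expansion is its initial value plus a multiple of [ds] or [dt], and
    the initial values cancel by [w0E]. The terms -2 p w.x and p^2 x.x contribute -p ds and p^2 ds;
    likewise those in y contribute q dt and q^2 dt. *)
Lemma defect_normE : dotp (w - p *: x - q *: y) (w - p *: x - q *: y) =
  p * (p - 1) * ds + q * (q + 1) * dt.
Proof.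
have xy := diagonal_dotp_const.
rewrite !dotp_lin (dotpC x w) (dotpC y w) (dotpC y x) xy AB.
have -> : dotp w x = dotp w0 x0 + ds / 2 by have := wx; lra.
have -> : dotp w y = dotp w0 y0 - dt / 2 by have := wy; lra.
have -> : dotp x x = dotp x0 x0 + ds by rewrite /ds; ring.
have -> : dotp y y = dotp y0 y0 + dt by rewrite /dt; ring.
by rewrite w0E !dotp_lin (dotpC y0 x0); field.
Qed.

(** The defect vanishes, so w = p x + q y still holds; pairing it with x and y gives (1 - 2p) ds = 0
    and (1 + 2q) dt = 0. Conclude with (1 - 2p)^2 - 4p(p - 1) = 1 and its analogue in q. *)
Lemma diagonals_rigid : p * (p - 1) * ds = 0 -> q * (q + 1) * dt = 0 ->
  ds = 0 /\ dt = 0.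
Proof.
move=> ps qt.
have /dotp_eq0/eqP : dotp (w - p *: x - q *: y) (w - p *: x - q *: y) = 0.
  by rewrite defect_normE ps qt addr0.
rewrite -addrA -opprD subr_eq0 => /eqP wE.
have xy := diagonal_dotp_const.
have s1 : (1 - 2 * p) * ds = 0.
  move: wx; rewrite wE w0E !dotp_lin (dotpC y x) (dotpC y0 x0) xy => h.
  by rewrite {1}/ds; move: h; rewrite {1}/ds; lra.
have t1 : (1 + 2 * q) * dt = 0.
  move: wy; rewrite wE w0E !dotp_lin xy => h.
  by move: h; rewrite /dt; lra.
split.
  transitivity ((1 - 2 * p) * ((1 - 2 * p) * ds) - 4 * (p * (p - 1) * ds)).
    by ring.
  by rewrite s1 ps; ring.
transitivity ((1 + 2 * q) * ((1 + 2 * q) * dt) - 4 * (q * (q + 1) * dt)).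
  by ring.
by rewrite t1 qt; ring.
Qed.

End EdgeEquations.

Lemma deformation_edges (R : realType) (A B C D : 'cV[R]_2) (e : R)
    (p : R -> vertex -> 'cV[R]_2) (pi : R -> Gam -> 'cV[R]_2) (t : R) :
  deformation A B C D e p pi -> t \in `]- e, e[ ->
  let w := p t (VB 0) - p t (VA 0) in
  let x := pi t gamma1 in let y := pi t gamma2 in
  [/\ dotp w w = dotp (B - A) (B - A),
      dotp (x - w) (x - w) = dotp (C - A - (B - A)) (C - A - (B - A)),
      dotp (w + y - x) (w + y - x) =
        dotp (B - A + (D - B) - (C - A)) (B - A + (D - B) - (C - A)) &
      dotp (w + y) (w + y) = dotp (B - A + (D - B)) (B - A + (D - B))].
Proof.
move=> [plc _ _ [p0 pi0] len] tI w x y.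
have [_ _ _ eqv] := plc t tI.
have pA g : p t (VA g) = p t (VA 0) + pi t g.
  by have := eqv g (VA 0); rewrite /= addr0.
have pB g : p t (VB g) = p t (VB 0) + pi t g.
  by have := eqv g (VB 0); rewrite /= addr0.
have p0A : p 0 (VA 0) = A by rewrite p0 /= framework_trans0 addr0.
have p0B : p 0 (VB 0) = B by rewrite p0 /= framework_trans0 addr0.
have p0C : p 0 (VA gamma1) = C by rewrite p0 /= framework_trans1 addrC subrK.
have p0D : p 0 (VB gamma2) = D by rewrite p0 /= framework_trans2 addrC subrK.
(* Signs are allowed because the bar from D to A runs against the vector w + y. *)
have eq2 (u v u' v' : 'cV[R]_2) : u = u' \/ u = - u' -> v = v' \/ v = - v' ->
    dotp u u = dotp v v -> dotp u' u' = dotp v' v'.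
  by case=> ->; case=> ->; rewrite ?(dotpNl, dotpNr) ?opprK.
split.
- have /eudist_dotp := len _ _ (barAB 0) t tI.
  by rewrite p0A p0B.
- have /eudist_dotp := len _ _ (barBC 0) t tI.
  rewrite add0r p0B p0C pA; apply: eq2; left;
    by apply: vec2P; rewrite !mxE; ring.
- have /eudist_dotp := len _ _ (barCD 0) t tI.
  rewrite !add0r p0C p0D pA pB; apply: eq2; left;
    by apply: vec2P; rewrite !mxE; ring.
- have /eudist_dotp := len _ _ (barDA 0) t tI.
  rewrite !add0r p0D p0A pB; apply: eq2; right;
    by apply: vec2P; rewrite !mxE; ring.
Qed.

(** * From an auxetic deformation to the sign condition *)

Lemma auxetic_signs (R : realType) (A B C D : 'cV[R]_2) (p q : R) :
  B - A = p *: (C - A) + q *: (D - B) ->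
  has_local_auxetic_deformation A B C D ->
  p * (p - 1) * (q * (q + 1)) < 0.
Proof.
move=> w0E [e [P [pi [e0 def aux ntriv]]]].
rewrite ltNge; apply/negP => cc; apply: ntriv.
have zI : (0 : R) \in `]- e, e[ by rewrite in_itv/= oppr_lt0 e0.
have [_ _ smpi [_ pi0] _] := def.
have dpi t : t \in `]- e, e[ -> forall g, derivable (fun s => pi s g) t 1.
  by move=> tI g; exact: (smpi g 0%N).
pose s t := dotp (pi t gamma1) (pi t gamma1).
pose r t := dotp (pi t gamma2) (pi t gamma2).
pose k t := dotp (pi t gamma1) (pi t gamma2).
have dis t : t \in `]- e, e[ -> derivable s t 1.
  by move=> tI; apply: derivable_dotp; apply: dpi.
have dir t : t \in `]- e, e[ -> derivable r t 1.
  by move=> tI; apply: derivable_dotp; apply: dpi.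
have dik t : t \in `]- e, e[ -> derivable k t 1.
  by move=> tI; apply: derivable_dotp; apply: dpi.
have smono : {in `]- e, e[ &, {homo s : a b / a <= b}}.
  apply: derive1_ge0_ndecr_oo => // t tI.
  by have [+ _] := psd_diag_ge0 (aux t tI); rewrite derive_gram//; exact: dpi.
have rmono : {in `]- e, e[ &, {homo r : a b / a <= b}}.
  apply: derive1_ge0_ndecr_oo => // t tI.
  by have [_] := psd_diag_ge0 (aux t tI); rewrite derive_gram//; exact: dpi.
have s0E : s 0 = dotp (C - A) (C - A) by rewrite /s pi0 framework_trans1.
have r0E : r 0 = dotp (D - B) (D - B) by rewrite /r pi0 framework_trans2.
have k0E : k 0 = dotp (C - A) (D - B).
  by rewrite /k !pi0 framework_trans1 framework_trans2.
have kc t : t \in `]- e, e[ -> k t = k 0.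
  move=> tI; have [h1 h2 h3 h4] := deformation_edges def tI.
  by rewrite k0E; exact: diagonal_dotp_const h1 h2 h3 h4.
have defect t : t \in `]- e, e[ ->
    0 <= p * (p - 1) * (s t - s 0) + q * (q + 1) * (r t - r 0).
  move=> tI; have [h1 h2 h3 h4] := deformation_edges def tI.
  by rewrite s0E r0E -(defect_normE w0E h1 h2 h3 h4) dotp_ge0.
(* Two nonpositive terms with a nonnegative sum both vanish, as [diagonals_rigid] requires. *)
have rigid t : t \in `]- e, e[ ->
    p * (p - 1) * (s t - s 0) <= 0 -> q * (q + 1) * (r t - r 0) <= 0 ->
    s t = s 0 /\ r t = r 0.
  move=> tI c1 c2; have := defect t tI => c3.
  have [h1 h2 h3 h4] := deformation_edges def tI.
  have [] := diagonals_rigid w0E h1 h2 h3 h4.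
  - by rewrite -s0E -/(s t); lra.
  - by rewrite -r0E -/(r t); lra.
  - rewrite -s0E -r0E -/(s t) -/(r t) => h5 h6; split; lra.
have half : (forall h, 0 <= h < e -> s h = s 0 /\ r h = r 0) \/
            (forall h, - e < h <= 0 -> s h = s 0 /\ r h = r 0).
  (* The common weak sign of the two coefficients selects the side: nonpositive ones freeze s and r
     after 0, where the increments are nonnegative; nonnegative ones freeze them before 0. *)
  have : (p * (p - 1) <= 0 /\ q * (q + 1) <= 0) \/
         (0 <= p * (p - 1) /\ 0 <= q * (q + 1)).
    move: cc; set c1 := p * (p - 1); set c2 := q * (q + 1).
    case: (ltgtP c1 0) => [c10|c10|->].
    - by rewrite nmulr_rge0// => c20; left; split=> //; exact: ltW.
    - by rewrite pmulr_rge0// => c20; right; split=> //; exact: ltW.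
    - by move=> _; case: (leP c2 0) => [|/ltW] c20; [left|right].
  case=> -[c1 c2]; [left=> h /andP[h0 he]|right=> h /andP[he h0]].
    have hI : h \in `]- e, e[.
      by rewrite in_itv/= he andbT (lt_le_trans _ h0)// oppr_lt0.
    have := smono _ _ zI hI h0; have := rmono _ _ zI hI h0 => h1 h2.
    by apply: rigid => //; rewrite mulr_le0_ge0 ?subr_ge0.
  have hI : h \in `]- e, e[ by rewrite in_itv/= he (le_lt_trans h0).
  have := smono _ _ hI zI h0; have := rmono _ _ hI zI h0 => h1 h2.
  by apply: rigid => //; rewrite mulr_ge0_le0 ?subr_le0.
have s'0 : derive1 s 0 = 0.
  apply: (derive1_const_half e0); first exact: dis.
  by case: half => H; [left|right] => h /H[].
have r'0 : derive1 r 0 = 0.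
  apply: (derive1_const_half e0); first exact: dir.
  by case: half => H; [left|right] => h /H[].
have k'0 : derive1 k 0 = 0.
  apply: (derive1_const_half e0); first exact: dik.
  left=> h /andP[h0 he]; apply: kc.
  by rewrite in_itv/= he andbT (lt_le_trans _ h0)// oppr_lt0.
apply/matrixP => i j; rewrite derive_gram; last exact: dpi.
rewrite mxE; case: (ord2P i) => ->; case: (ord2P j) => -> //=.
by rewrite -[RHS]k'0; congr (derive1 _ 0); apply/funext => t; exact: dotpC.
Qed.

(** * Elementary functions and smoothness *)

(* Closed under differentiation, since (sqrt f)' = f' / (2 sqrt f). *)
Inductive elementary (R : realType) (e : R) : (R -> R) -> Prop :=
| elem_cst (c : R) : elementary e (fun=> c)
| elem_id : elementary e (fun t => t)
| elem_add f g : elementary e f -> elementary e g ->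
    elementary e (fun t => f t + g t)
| elem_mul f g : elementary e f -> elementary e g ->
    elementary e (fun t => f t * g t)
| elem_inv f : elementary e f -> (forall t, t \in `]- e, e[ -> f t != 0) ->
    elementary e (fun t => (f t)^-1)
| elem_sqrt f : elementary e f -> (forall t, t \in `]- e, e[ -> 0 < f t) ->
    elementary e (fun t => Num.sqrt (f t)).

Section Elementary.
Variables (R : realType) (e : R).

Lemma elem_ext f g : f =1 g -> elementary e f -> elementary e g.
Proof. by move=> /funext ->. Qed.

Lemma elem_opp f : elementary e f -> elementary e (fun t => - f t).
Proof.
move=> ef; apply: (elem_ext _ (elem_mul (elem_cst e (-1)) ef)) => t.
by rewrite mulN1r.
Qed.

Lemma elem_sub f g : elementary e f -> elementary e g ->
  elementary e (fun t => f t - g t).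
Proof. by move=> ef eg; apply: elem_add => //; exact: elem_opp. Qed.

Lemma elem_sqr f : elementary e f -> elementary e (fun t => f t ^+ 2).
Proof.
by move=> ef; apply: (elem_ext _ (elem_mul ef ef)) => t; rewrite expr2.
Qed.

Lemma elementary_le (e' : R) f : e' <= e -> elementary e f -> elementary e' f.
Proof.
move=> e'e.
have sub t : t \in `]- e', e'[ -> t \in `]- e, e[.
  rewrite !in_itv/= => /andP[h1 h2].
  by rewrite (lt_le_trans h2 e'e) andbT (le_lt_trans _ h1)// lerN2.
elim=> {f} [c||f g _ ef _ eg|f g _ ef _ eg|f _ ef f0|f _ ef f0].
- exact: elem_cst.
- exact: elem_id.
- exact: elem_add.
- exact: elem_mul.
- by apply: elem_inv => // t /sub; exact: f0.
- by apply: elem_sqrt => // t /sub; exact: f0.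
Qed.

Lemma elementary_derive f : elementary e f ->
  exists2 g, elementary e g & forall t, t \in `]- e, e[ -> is_derive t 1 f (g t).
Proof.
elim=> {f} [c||f g ef [f' ef' df] eg [g' eg' dg]
  |f g ef [f' ef' df] eg [g' eg' dg]|f ef [f' ef' df] f0|f ef [f' ef' df] f0].
- by exists (fun=> 0); [exact: elem_cst|move=> t _; exact: is_derive_cst].
- by exists (fun=> 1); [exact: elem_cst|move=> t _; exact: is_derive_id].
- exists (fun t => f' t + g' t); first exact: elem_add.
  by move=> t tI; apply: is_deriveD; [exact: df|exact: dg].
- exists (fun t => f t * g' t + g t * f' t).
    by apply: elem_add; apply: elem_mul.
  by move=> t tI; apply: is_deriveM; [exact: df|exact: dg].
- exists (fun t => - ((f t)^-1 * (f t)^-1) * f' t).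
    apply: elem_mul => //; apply: elem_opp.
    by apply: elem_mul; apply: elem_inv.
  move=> t tI; have := is_deriveV (f0 t tI) (df t tI).
  by rewrite -exprVn expr2.
- exists (fun t => (2 * Num.sqrt (f t))^-1 * f' t).
    apply: elem_mul => //; apply: elem_inv => [|t tI].
      by apply: elem_mul; [exact: elem_cst|exact: elem_sqrt].
    by rewrite mulf_neq0// gt_eqF// sqrtr_gt0 f0.
  move=> t tI; have := @is_derive1_comp _ Num.sqrt f t _ _
    (is_derive1_sqrt (f0 t tI)) (df t tI).
  exact.
Qed.

Lemma elementary_pos f : 0 < e -> elementary e f -> 0 < f 0 ->
  exists2 e', 0 < e' <= e & forall t, t \in `]- e', e'[ -> 0 < f t.
Proof.
move=> e0 ef f0; have [g _ dg] := elementary_derive ef.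
have zI : (0 : R) \in `]- e, e[ by rewrite in_itv/= oppr_lt0 e0.
have cf : {for 0, continuous f}.
  apply: differentiable_continuous; apply/derivable1_diffP.
  by have [] := dg 0 zI.
have /nbhs_ballP[d /= d0 fd] : \forall t \near 0, 0 < f t.
  exact: (cvgr_gt (f 0) cf).
exists (Num.min d e); first by rewrite lt_min d0 e0 ge_min lexx orbT.
move=> t; rewrite in_itv/= => /andP[h1 h2]; apply: fd.
rewrite /ball/= sub0r normrN ltr_norml.
have md : Num.min d e <= d by rewrite ge_min lexx.
by rewrite (lt_le_trans h2 md) andbT (le_lt_trans _ h1)// lerN2.
Qed.

Definition elementary_vec (F : R -> 'cV[R]_2) :=
  forall i, elementary e (fun t => F t i 0).

Lemma elemv_cst c : elementary_vec (fun=> c).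
Proof. by move=> i; exact: elem_cst. Qed.

Lemma elemv_add F G : elementary_vec F -> elementary_vec G ->
  elementary_vec (fun t => F t + G t).
Proof.
move=> eF eG i; apply: (elem_ext _ (elem_add (eF i) (eG i))) => t.
by rewrite mxE.
Qed.

Lemma elemv_scale f G : elementary e f -> elementary_vec G ->
  elementary_vec (fun t => f t *: G t).
Proof.
move=> ef eG i; apply: (elem_ext _ (elem_mul ef (eG i))) => t.
by rewrite mxE.
Qed.

Lemma elemv_int F n : elementary_vec F -> elementary_vec (fun t => F t *~ n).
Proof.
move=> eF i.
apply: (elem_ext _ (elemv_scale (elem_cst e n%:~R) eF i)) => t.
by rewrite scaler_int.
Qed.

Lemma elem_dotp F G : elementary_vec F -> elementary_vec G ->
  elementary e (fun t => dotp (F t) (G t)).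
Proof.
move=> eF eG; apply: (elem_ext _ (elem_add (elem_mul (eF 0) (eG 0))
  (elem_mul (eF 1) (eG 1)))) => t.
by rewrite dotpE.
Qed.

Lemma elem_cross F G : elementary_vec F -> elementary_vec G ->
  elementary e (fun t => cross (F t) (G t)).
Proof.
move=> eF eG; exact: (elem_sub (elem_mul (eF 0) (eG 1)) (elem_mul (eF 1) (eG 0))).
Qed.

Lemma elementary_vec_derive F : elementary_vec F ->
  exists2 G, elementary_vec G & forall t, t \in `]- e, e[ -> is_derive t 1 F (G t).
Proof.
move=> eF.
have [g0 eg0 dg0] := elementary_derive (eF 0).
have [g1 eg1 dg1] := elementary_derive (eF 1).
exists (fun t => vec2 (g0 t) (g1 t)) => [i|t tI].
  by case: (ord2P i) => ->; [apply: elem_ext eg0|apply: elem_ext eg1] => t;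
    rewrite ?vec2_0 ?vec2_1.
have dF : derivable F t 1.
  apply/derivable_mxP => i j; rewrite (ord1 j).
  by case: (ord2P i) => ->; [case: (dg0 t tI)|case: (dg1 t tI)].
apply: DeriveDef => //; rewrite derive_mx//.
apply: vec2P; rewrite mxE ?vec2_0 ?vec2_1.
  by case: (dg0 t tI).
by case: (dg1 t tI).
Qed.

(** By induction every iterated derivative agrees with an elementary map. The agreement holds only
    on the open interval, so derivatives are compared through equality near the point. *)
Lemma elementary_vec_smooth F : elementary_vec F -> smooth_on e F.
Proof.
move=> eF n.
suff [G eG FG] : exists2 G, elementary_vec G &
    forall t, t \in `]- e, e[ -> derive1n n F t = G t.
  have [H _ dH] := elementary_vec_derive eG.
  move=> t tI; have [dG _] := dH t tI; apply: near_eq_derivable dG.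
  by near=> s; rewrite FG//; near: s; exact: near_in_itvoo.
elim: n => [|n [G eG FG]]; first by exists F.
have [H eH dH] := elementary_vec_derive eG.
exists H => // t tI; rewrite derive1nS derive1E.
have [_ <-] := dH t tI; apply: near_eq_derive.
by near=> s; rewrite FG//; near: s; exact: near_in_itvoo.
Unshelve. all: by end_near. Qed.

End Elementary.

(** * The flex of the framework *)

Definition quarter_turn (R : realType) (u : 'cV[R]_2) : 'cV[R]_2 :=
  vec2 (- u 1 0) (u 0 0).

Lemma dotp_frame (R : realType) (x0 : 'cV[R]_2) (a h b k : R) :
  dotp (a *: x0 + h *: quarter_turn x0) (b *: x0 + k *: quarter_turn x0) =
  (a * b + h * k) * dotp x0 x0.
Proof. by rewrite !dotpE !mxE/=; ring. Qed.

(* The apex opposite a stretched side [(1 + t) x0] keeps its two other sides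
   rigid; the height, being nonzero, is a smooth square root. *)
Lemma triangle_flex (R : realType) (x0 z0 : 'cV[R]_2) : cross x0 z0 != 0 ->
  exists e : R, exists2 z : R -> 'cV[R]_2,
    0 < e < 1 /\ elementary_vec e z &
    z 0 = z0 /\ forall t, t \in `]- e, e[ ->
      dotp (z t) (z t) = dotp z0 z0 /\
      dotp (z t - (1 + t) *: x0) (z t - (1 + t) *: x0) =
        dotp (z0 - x0) (z0 - x0).
Proof.
move=> xz0; set s := dotp x0 x0.
have s0 : 0 < s.
  rewrite lt_neqAle dotp_ge0 andbT eq_sym; apply/eqP => /dotp_eq0 x00.
  by move: xz0; rewrite /cross x00 !mxE !mul0r subr0 eqxx.
set L := dotp z0 z0; set M := dotp (z0 - x0) (z0 - x0).
(* The apex is written a x0 + h J x0 with J the quarter turn; [h0] is the initial signed height in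
   this frame. *)
pose h0 := cross x0 z0 / s.
have h00 : h0 != 0 by rewrite mulf_neq0// invr_neq0// gt_eqF.
(* The foot of the height, from the law of cosines. The squared height is then L / s - a^2, and [g]
   is its ratio to the initial one, so that [h0] times the root of [g] keeps the orientation of the
   triangle. *)
pose a t := ((1 + t) ^+ 2 * s + (L - M)) * (2 * (1 + t) * s)^-1.
pose g t := (L / s - a t ^+ 2) * (h0 ^+ 2)^-1.
(* The radius 1/2 keeps 1 + t away from zero. *)
have ea : elementary 2^-1 a.
  have e1 : elementary (2^-1 : R) (fun t => 1 + t).
    by apply: elem_add; [exact: elem_cst|exact: elem_id].
  apply: elem_mul; first apply: elem_add.
  - by apply: elem_mul; [exact: elem_sqr|exact: elem_cst].
  - exact: elem_cst.
  - apply: elem_inv.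
      by apply: elem_mul; [apply: elem_mul => //; exact: elem_cst|exact: elem_cst].
    move=> t; rewrite in_itv/= => /andP[h1 h2].
    rewrite mulf_neq0 ?(gt_eqF s0)// mulf_neq0//.
    by apply: lt0r_neq0; lra.
have eg : elementary 2^-1 g.
  apply: elem_mul; last exact: elem_cst.
  by apply: elem_sub; [exact: elem_cst|exact: elem_sqr].
have a0E : a 0 = dotp z0 x0 / s.
  have LM : L - M = 2 * dotp z0 x0 - s.
    by rewrite /M !dotp_lin (dotpC x0 z0) -/L -/s; ring.
  by rewrite /a LM; move: (lt0r_neq0 s0) => ?; field.
have Ls : L * s = dotp z0 x0 ^+ 2 + cross x0 z0 ^+ 2.
  by rewrite /L /s !dotpE /cross; ring.
have LE : L / s - a 0 ^+ 2 = h0 ^+ 2.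
  have -> : L = (dotp z0 x0 ^+ 2 + cross x0 z0 ^+ 2) / s.
    by rewrite -Ls mulfK// gt_eqF.
  by rewrite a0E /h0; move: (lt0r_neq0 s0) => ?; field.
have g0 : g 0 = 1 by rewrite /g LE divff// expf_neq0.
have [|||e /andP[e0 e2] gpos] := @elementary_pos R 2^-1 g => //.
  by rewrite g0.
pose h t := h0 * Num.sqrt (g t).
have eh : elementary e h.
  apply: elem_mul; first exact: elem_cst.
  by apply: elem_sqrt => //; exact: elementary_le eg.
exists e, (fun t => a t *: x0 + h t *: quarter_turn x0).
  split; first by rewrite e0 (le_lt_trans e2)// invf_lt1// ltr1n.
  apply: elemv_add; apply: elemv_scale => //; try exact: elemv_cst.
  exact: elementary_le ea.
split=> [|t tI].
  rewrite /h g0 sqrtr1 mulr1 a0E /h0 /s; move: (lt0r_neq0 s0); rewrite /s => ?.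
  apply: vec2P; rewrite !mxE/= /cross; move: (lt0r_neq0 s0); rewrite /s !dotpE.
    by move=> ?; field.
  by move=> ?; field.
have ahE : (a t * a t + h t * h t) * s = L.
  have -> : h t * h t = h0 ^+ 2 * g t.
    by rewrite /h -expr2 exprMn sqr_sqrtr// ltW// gpos.
  have -> : h0 ^+ 2 * g t = L / s - a t ^+ 2.
    by rewrite /g mulrC divfK// expf_neq0.
  by rewrite -expr2 addrC subrK divfK// gt_eqF.
split; first by rewrite dotp_frame.
have -> : a t *: x0 + h t *: quarter_turn x0 - (1 + t) *: x0 =
    (a t - (1 + t)) *: x0 + h t *: quarter_turn x0.
  by rewrite scalerBl addrAC.
rewrite dotp_frame -/s -/M.
have aE : 2 * a t * (1 + t) * s = (1 + t) ^+ 2 * s + (L - M).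
  have t1 : 2 * (1 + t) * s != 0.
    move: tI; rewrite in_itv/= => /andP[t1 t2].
    rewrite mulf_neq0 ?(gt_eqF s0)// mulf_neq0//.
    by apply: lt0r_neq0; lra.
  rewrite [RHS](_ : _ = a t * (2 * (1 + t) * s)); last by rewrite /a divfK.
  by ring.
by move: aE ahE => aE ahE; lra.
Qed.

Lemma itv_le (R : realType) (a b t : R) : a <= b -> t \in `]- a, a[ ->
  t \in `]- b, b[.
Proof.
move=> ab; rewrite !in_itv/= => /andP[h1 h2].
by rewrite (lt_le_trans h2 ab) andbT (le_lt_trans _ h1)// lerN2.
Qed.

Definition lattice_trans (R : realType) (x y : 'cV[R]_2) (g : Gam) : 'cV[R]_2 :=
  x *~ g.1 + y *~ g.2.

Definition lattice_pos (R : realType) (A w x y : 'cV[R]_2) (v : vertex) :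
  'cV[R]_2 :=
  match v with
  | VA g => A + lattice_trans x y g
  | VB g => A + w + lattice_trans x y g
  end.

Lemma lattice_placement (R : realType) (A w x y : 'cV[R]_2) :
  cross x y != 0 -> placement (lattice_pos A w x y) (lattice_trans x y).
Proof.
move=> xy; have addT (g h : Gam) : lattice_trans x y (g + h) =
    lattice_trans x y g + lattice_trans x y h.
  by rewrite /lattice_trans !mulrzDr addrACA.
split=> //.
- move=> [g1 g2] [h1 h2]; rewrite /lattice_trans/= => gh.
  have crx : cross (x *~ g1 + y *~ g2) y = cross (x *~ h1 + y *~ h2) y.
    by rewrite gh.
  have cry : cross x (x *~ g1 + y *~ g2) = cross x (x *~ h1 + y *~ h2).
    by rewrite gh.
  (* Crossing with y, respectively x, recovers the integer coordinates of a lattice vector. *)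
  have E1 m n : cross (x *~ m + y *~ n) y = m%:~R * cross x y.
    rewrite -(scaler_int m x) -(scaler_int n y); move: m%:~R n%:~R => a b.
    by rewrite /cross !mxE; ring.
  have E2 m n : cross x (x *~ m + y *~ n) = n%:~R * cross x y.
    rewrite -(scaler_int m x) -(scaler_int n y); move: m%:~R n%:~R => a b.
    by rewrite /cross !mxE; ring.
  move: crx cry; rewrite !E1 !E2 => /(mulIf xy)/intr_inj -> /(mulIf xy)/intr_inj ->.
  by [].
- exists x, y; split; first exact/cross_free.
  apply/seteqP; split=> [_ [g _ <-]|_ [m [n ->]]]; first by exists g.1, g.2.
  by exists (m, n).
- by move=> g [h|h] /=; rewrite addT [in RHS]addrAC -addrA.
Qed.

(** Stretching AC drives the triangles with apexes B and D on this common side, each flexed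
    independently. They are non-degenerate because [neg] excludes q = 0 and q = -1, so neither B nor
    D lies on the line AC. The other diagonal is recovered as AD - AB. *)
Lemma quadrilateral_flex (R : realType) (x0 y0 w0 : 'cV[R]_2) (p q : R) :
  cross x0 y0 != 0 -> w0 = p *: x0 + q *: y0 ->
  p * (p - 1) * (q * (q + 1)) < 0 ->
  exists (e : R) (w y : R -> 'cV[R]_2),
    [/\ 0 < e < 1, elementary_vec e w, elementary_vec e y,
        w 0 = w0 /\ y 0 = y0 &
        forall t, t \in `]- e, e[ -> let x := (1 + t) *: x0 in
          [/\ dotp (w t) (w t) = dotp w0 w0,
              dotp (x - w t) (x - w t) = dotp (x0 - w0) (x0 - w0),
              dotp (w t + y t - x) (w t + y t - x) =
                dotp (w0 + y0 - x0) (w0 + y0 - x0) &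
              dotp (w t + y t) (w t + y t) = dotp (w0 + y0) (w0 + y0)]].
Proof.
move=> xy w0E neg.
have q0 : q != 0 by apply: contraTneq neg => ->; rewrite mul0r mulr0 ltxx.
have q1 : q + 1 != 0 by apply: contraTneq neg => ->; rewrite !mulr0 ltxx.
have [|e1 [w [/andP[e10 e11] ew] [w00 wE]]] := @triangle_flex R x0 w0.
  have -> : cross x0 w0 = q * cross x0 y0 by rewrite w0E /cross !mxE; ring.
  exact: mulf_neq0.
have [|e2 [z [/andP[e20 e21] ez] [z00 zE]]] := @triangle_flex R x0 (w0 + y0).
  have -> : cross x0 (w0 + y0) = (q + 1) * cross x0 y0.
    by rewrite w0E /cross !mxE; ring.
  exact: mulf_neq0.
pose e := Num.min e1 e2.
have ee1 : e <= e1 by rewrite ge_min lexx.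
have ee2 : e <= e2 by rewrite ge_min lexx orbT.
have {}ew : elementary_vec e w by move=> i; apply: elementary_le (ew i).
have {}ez : elementary_vec e z by move=> i; apply: elementary_le (ez i).
exists e, w, (fun t => z t + (-1) *: w t); split=> //.
- by rewrite lt_min e10 e20 (le_lt_trans ee1).
- by apply: elemv_add => //; apply: elemv_scale => //; exact: elem_cst.
- by rewrite z00 w00 scaleN1r addrAC subrr add0r.
move=> t tI x.
have [h1 h2] := wE t (itv_le ee1 tI); have [h3 h4] := zE t (itv_le ee2 tI).
rewrite scaleN1r [w t + _]addrC subrK; split=> //.
by rewrite -(opprB (w t)) -(opprB w0) !dotpNl !dotpNr !opprK.
Qed.

(** * From the sign condition to an auxetic deformation *)

Lemma auxetic_exists (R : realType) (A B C D : 'cV[R]_2) (p q : R) :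
  cross (C - A) (D - B) != 0 -> B - A = p *: (C - A) + q *: (D - B) ->
  p * (p - 1) * (q * (q + 1)) < 0 -> has_local_auxetic_deformation A B C D.
Proof.
move=> xy w0E neg.
have [e [w [y [/andP[e0 e1] ew ey [w0 y0] edges]]]] := quadrilateral_flex xy w0E neg.
set x0 := C - A in xy w0E edges; set yy := D - B in xy w0E edges y0.
pose x t := (1 + t) *: x0.
have ex : elementary_vec e x.
  apply: elemv_scale; last exact: elemv_cst.
  by apply: elem_add; [exact: elem_cst|exact: elem_id].
have x0E : x 0 = x0 by rewrite /x addr0 scale1r.
pose s t := dotp (x t) (x t); pose r t := dotp (y t) (y t).
have s0 : 0 < s 0.
  rewrite lt_neqAle dotp_ge0 andbT eq_sym; apply/eqP => /dotp_eq0.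
  by move=> x00; move: xy; rewrite -x0E /cross x00 !mxE !mul0r subr0 eqxx.
have zI : (0 : R) \in `]- e, e[ by rewrite in_itv/= oppr_lt0 e0.
have ds (t : R) : is_derive t 1 s (2 * (1 + t) * s 0).
  have -> : s = (fun t => (1 + t) * (1 + t) * s 0).
    by apply/funext => u; rewrite /s x0E /x !dotp_lin; ring.
  apply: is_derive_eq; rewrite addr0 /GRing.scale/=; ring.
have [r' er' dr] := elementary_derive (elem_dotp ey ey).
have r'0 : 0 < r' 0.
  (* By [defect_normE], [N t - N 0] is a squared norm, so [N] is minimal at 0 and its derivative
     vanishes there. This determines r'(0) from s'(0) = 2 s(0). *)
  pose N t := p * (p - 1) * s t + q * (q + 1) * r t.
  have dN t : t \in `]- e, e[ -> is_derive t 1 N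
      (p * (p - 1) * (2 * (1 + t) * s 0) + q * (q + 1) * r' t).
    move=> tI; have := ds t; have := dr t tI => ? ?.
    by apply: is_derive_eq; rewrite /GRing.scale/=; ring.
  have : is_derive (0 : R) (1 : R) N 0.
    apply: (@derive1_at_min R N (- e) e 0).
    - by rewrite (@le_trans _ _ 0) ?oppr_le0 ?ltW.
    - by move=> t /dN [].
    - exact: zI.
    - move=> t tI; have [h1 h2 h3 h4] := edges t tI.
      have := dotp_ge0 (w t - p *: x t - q *: y t).
      rewrite (defect_normE w0E h1 h2 h3 h4) /N -/(s t) -/(r t) -y0 -x0E.
      by rewrite -/(s 0) -/(r 0); lra.
  have [_ +] := dN 0 zI; move=> + [_ NE]; rewrite NE => /esym.
  rewrite addr0 mulr1 => h.
  have c20 : q * (q + 1) != 0 by apply: contraTneq neg => ->; rewrite mulr0 ltxx.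
  (* Written over the square of q(q + 1), the sign of r'(0) is read off from [neg]. *)
  have -> : r' 0 = - (p * (p - 1) * (q * (q + 1))) * (2 * s 0) / (q * (q + 1)) ^+ 2.
    apply: (mulfI c20); apply: (addrI (p * (p - 1) * (2 * s 0))); rewrite h.
    by move: c20; rewrite mulf_eq0 negb_or => /andP[? ?]; field; apply/andP.
  by rewrite divr_gt0 ?exprn_even_gt0// mulr_gt0 ?oppr_gt0// mulr_gt0.
(* The interval is shrunk twice: to keep x and y independent, by the positivity of [cross x y] times
   its initial value, and to keep r' positive. *)
have [|e3 /andP[e30 e3e] cr] := elementary_pos e0
  (elem_mul (elem_cst e (cross x0 yy)) (elem_cross ex ey)).
  by rewrite y0 x0E -expr2 exprn_even_gt0.
have [e4 /andP[e40 e4e] r'pos] := elementary_pos e0 er' r'0.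
pose d := Num.min e3 e4.
have d0 : 0 < d by rewrite lt_min e30 e40.
have de3 : d <= e3 by rewrite ge_min lexx.
have de4 : d <= e4 by rewrite ge_min lexx orbT.
have de : d <= e by exact: le_trans e3e.
have elemv_d F : elementary_vec e F -> elementary_vec d F.
  by move=> eF i; apply: elementary_le (eF i).
have epi g : elementary_vec d (fun t => lattice_trans (x t) (y t) g).
  by apply: elemv_add; apply: elemv_int; exact: elemv_d.
have dpi t : t \in `]- d, d[ -> forall g,
    derivable (fun t => lattice_trans (x t) (y t) g) t 1.
  by move=> tI g; have sm := elementary_vec_smooth (epi g); exact: (sm 0%N t tI).
have g1E t : lattice_trans (x t) (y t) gamma1 = x t.
  by rewrite /lattice_trans/= mulr0z addr0.
have g2E t : lattice_trans (x t) (y t) gamma2 = y t.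
  by rewrite /lattice_trans/= mulr0z add0r.
have kE t : t \in `]- d, d[ ->
    'D_1 (fun t => dotp (x t) (y t)) t = 0.
  move=> tI; rewrite -(derive_cst (dotp x0 yy) t 1); apply: near_eq_derive.
  near=> u; have uI : u \in `]- d, d[ by near: u; exact: near_in_itvoo.
  have [h1 h2 h3 h4] := edges u (itv_le de uI).
  exact: diagonal_dotp_const h1 h2 h3 h4.
(* As x.y is constant, the derivative of the Gram matrix is diagonal, and both its entries are
   positive for t in the shrunken interval. *)
have gram' t : t \in `]- d, d[ ->
    let M := derive1 (fun t => gram (lattice_trans (x t) (y t))) t in
    [/\ M 0 0 = 2 * (1 + t) * s 0, M 1 1 = r' t, M 0 1 = 0 & M 1 0 = 0].
  move=> tI M; rewrite /M !derive_gram; try exact: dpi.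
  rewrite !derive1E /basis_vector/=; split.
  - have [_ <-] := ds t.
    by congr ('D_1 _ t); apply/funext => u; rewrite g1E.
  - have [_ <-] := dr t (itv_le de tI).
    by congr ('D_1 _ t); apply/funext => u; rewrite g2E.
  - rewrite -[RHS](kE t tI).
    by congr ('D_1 _ t); apply/funext => u; rewrite g1E g2E.
  - rewrite -[RHS](kE t tI).
    by congr ('D_1 _ t); apply/funext => u; rewrite g1E g2E dotpC.
exists d, (fun t => lattice_pos A (w t) (x t) (y t)),
  (fun t => lattice_trans (x t) (y t)); split.
- exact: d0.
- split.
  + move=> t tI; apply: lattice_placement; apply: contraTneq (cr t (itv_le de3 tI)).
    by move=> ->; rewrite mulr0 ltxx.
  + move=> [g|g]; apply: elementary_vec_smooth; apply: elemv_add => //.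
      exact: elemv_cst.
    by apply: elemv_add; [exact: elemv_cst|exact: elemv_d].
  + by move=> g; exact: elementary_vec_smooth.
  + split=> [[g|g]|g]; rewrite /= /lattice_trans x0E y0//.
    by rewrite w0 [A + _]addrC subrK.
  + move=> u v uv t tI.
    have [h1 h2 h3 h4] := edges t (itv_le de tI).
    have [i1 i2 i3 i4] := edges 0 zI.
    have gE g v' : lattice_trans (x v') (y v') (g + gamma1) =
        lattice_trans (x v') (y v') g + x v'.
      by rewrite /lattice_trans !mulrzDr/= mulr0z mulr1z addr0 addrAC.
    have gE' g v' : lattice_trans (x v') (y v') (g + gamma2) =
        lattice_trans (x v') (y v') g + y v'.
      by rewrite /lattice_trans !mulrzDr/= mulr0z mulr1z addr0 addrA.
    apply/eudist_dotp; case: uv => g /=; rewrite ?gE ?gE'.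
    * transitivity (dotp (w t) (w t)); [|transitivity (dotp (w 0) (w 0))].
      - by congr dotp; apply: vec2P; rewrite !mxE; ring.
      - by rewrite h1 i1.
      - by congr dotp; apply: vec2P; rewrite !mxE; ring.
    * transitivity (dotp (x t - w t) (x t - w t));
        [|transitivity (dotp (x 0 - w 0) (x 0 - w 0))].
      - by congr dotp; apply: vec2P; rewrite !mxE; ring.
      - by rewrite h2 i2.
      - by congr dotp; apply: vec2P; rewrite !mxE; ring.
    * transitivity (dotp (w t + y t - x t) (w t + y t - x t));
        [|transitivity (dotp (w 0 + y 0 - x 0) (w 0 + y 0 - x 0))].
      - by congr dotp; apply: vec2P; rewrite !mxE; ring.
      - by rewrite h3 i3.
      - by congr dotp; apply: vec2P; rewrite !mxE; ring.
    * transitivity (dotp (w t + y t) (w t + y t));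
        [|transitivity (dotp (w 0 + y 0) (w 0 + y 0))].
      - by rewrite -[RHS]opprK -dotpNr -dotpNl; congr dotp;
          apply: vec2P; rewrite !mxE; ring.
      - by rewrite h4 i4.
      - by rewrite -[LHS]opprK -dotpNr -dotpNl; congr dotp;
          apply: vec2P; rewrite !mxE; ring.
- move=> t tI; apply/psdP; have [-> -> -> ->] := gram' t tI.
  split=> // a b; rewrite mulr0 !mul0r addr0.
  apply: addr_ge0; rewrite mulr_ge0 ?sqr_ge0// ltW//; last first.
    by apply: r'pos; exact: itv_le tI.
  rewrite !mulr_gt0//; have := itv_le de tI; rewrite in_itv/= => /andP[t1 t2].
  lra.
- have dI : (0 : R) \in `]- d, d[ by rewrite in_itv/= oppr_lt0 d0.
  have [M00 _ _ _] := gram' 0 dI; move=> M0; move: M00; rewrite M0 mxE addr0 mulr1.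
  by move=> /esym/eqP; rewrite mulf_eq0 pnatr_eq0/= (gt_eqF s0).
Unshelve. all: by end_near. Qed.

(** * Auxetic deformations and elliptic star conics *)

Unset Implicit Arguments.
Set Strict Implicit.

Theorem theorem6 (R : realType) (A B C D : 'cV[R]_2) (v : vertex)
    (quadABCD : quadrilateral A B C D) (genABCD : generic A B C D)
    (diag_free : free [:: C - A; D - B]) :
  has_local_auxetic_deformation A B C D <->
  exists2 K : set 'cV[R]_2,
    the_conic_through (framework_pos A B C D @` star v) K & is_ellipse K.
Proof.
have xy : cross (C - A) (D - B) != 0 by apply/cross_free.
(* The coordinates p and q of AB in the basis AC, BD are those given by Cramer's rule; both sides
   are compared with the sign of p(p - 1)q(q + 1). *)
have w0E := cross_decomp (B - A) xy.
rewrite (star_conic_ellipse v quadABCD xy w0E); split.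
  exact: auxetic_signs w0E.
exact: auxetic_exists xy w0E.
Qed.
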